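(* Let $p$ be a prime and $n\ge 1$. For every $\alpha=(\alpha_1,\dots,\alpha_n)\in\mathbb{C}^n$, the Lizorkin space of the first kind $\Phi_{\times}(\mathbb{Q}_p^n)$ is invariant under the Vladimirov fractional operator $D^{\alpha}_{\times}$; moreover, $$D^{\alpha}_{\times}\big(\Phi_{\times}(\mathbb{Q}_p^n)\big)=\Phi_{\times}(\mathbb{Q}_p^n).$$
   Context: $\mathbb{Q}_p$ is the field of $p$-adic numbers with norm $|p|_p=p^{-1}$ and Haar measure $dx$ normalized so that $\int_{|x|_p\le1}dx=1$; $d^nx=dx_1\cdots dx_n$; $B_0=\{x\in\mathbb{Q}_p:|x|_p\le 1\}$. $\mathcal{D}(\mathbb{Q}_p^n)$ is the space of locally constant compactly supported functions $\mathbb{Q}_p^n\to\mathbb{C}$, and $\mathcal{D}'(\mathbb{Q}_p^n)$ is the space of all linear functionals on it (distributions). Fourier transform: $F[\varphi](\xi)=\int_{\mathbb{Q}_p^n}\chi_p(\xi\cdot x)\varphi(x)\,d^nx$, with $\chi_p(\xi\cdot x)=e^{2\pi i\sum_j\{\xi_jx_j\}_p}$, $\{\cdot\}_p$ the $p$-adic fractional part. $\Psi_{\times}(\mathbb{Q}_p^n)=\{\psi\in\mathcal{D}(\mathbb{Q}_p^n):\psi(\xi_1,\dots,\xi_{j-1},0,\xi_{j+1},\dots,\xi_n)=0 \text{ for all } \xi_i\in\mathbb{Q}_p\ (i\neq j),\ j=1,\dots,n\}$. The Lizorkin space of test functions of the first kind is $\Phi_{\times}(\mathbb{Q}_p^n)=\{F[\psi]:\psi\in\Psi_{\times}(\mathbb{Q}_p^n)\}$.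 One-dimensional Riesz kernel $f_a\in\mathcal{D}'(\mathbb{Q}_p)$, $a\in\mathbb{C}$. Put $\mu_j=\frac{2\pi i}{\ln p}j$, $j\in\mathbb{Z}$, and $\Gamma_p(a)=\frac{1-p^{a-1}}{1-p^{-a}}$. For $a\ne\mu_j,\ 1+\mu_j$: $f_a(z)=|z|_p^{a-1}/\Gamma_p(a)$, where $|z|_p^{a-1}$ is the distribution $$\langle|z|_p^{a-1},\varphi\rangle=\int_{B_0}|z|_p^{a-1}(\varphi(z)-\varphi(0))\,dz+\int_{\mathbb{Q}_p\setminus B_0}|z|_p^{a-1}\varphi(z)\,dz+\varphi(0)\frac{1-p^{-1}}{1-p^{-a}}.$$ For $a=\mu_j$: $f_a=\delta$. For $a=1+\mu_j$: $f_a(z)=-\frac{1-p^{-1}}{\log p}\log|z|_p$ (locally integrable function). The multi-Riesz kernel is the direct product $f_{\alpha}(x)=f_{\alpha_1}(x_1)\times\cdots\times f_{\alpha_n}(x_n)$, and for $\phi\in\Phi_{\times}(\mathbb{Q}_p^n)$ the Vladimirov operator is $(D^{\alpha}_{\times}\phi)(x)=(f_{-\alpha}*\phi)(x)=\langle f_{-\alpha}(\xi),\phi(x-\xi)\rangle$, $x\in\mathbb{Q}_p^n$. *)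

(* Defs.v *)
From HB Require Import structures.
From mathcomp Require Import all_boot all_order all_algebra.
From mathcomp Require Import fraction ring_quotient generic_quotient complex.
From mathcomp Require Import ring.
From mathcomp Require Import all_classical all_reals all_analysis.

Set Implicit Arguments.
Unset Strict Implicit.
Unset Printing Implicit Defensive.

Import Order.TTheory GRing.Theory Num.Theory.
Local Open Scope complex_scope.
Local Open Scope classical_set_scope.
Local Open Scope ring_scope.

(* Z_p is the inverse limit of the rings Z/p^k: coherent sequences of integers
   (x (k+1) = x k mod p^k), modulo the sequences with x k = 0 mod p^k for
   all k. Q_p is its field of fractions. *)

Section CoherentSequences.
Variable p : nat.

Definition coherent : {pred nat -> int} :=
  fun x => `[< forall k, ((p ^ k)%N%:Z %| x k.+1 - x k)%Z >].

Lemma coherent_subring_closed : subring_closed coherent.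
Proof.
split=> [|x y /asboolP xc /asboolP yc|x y /asboolP xc /asboolP yc];
  apply/asboolP => k.
- by rewrite subrr dvdz0.
- have -> : (x - y) k.+1 - (x - y) k = (x k.+1 - x k) - (y k.+1 - y k).
    by rewrite !fctE; ring.
  by apply: rpredB; [exact: xc|exact: yc].
- have -> : (x * y) k.+1 - (x * y) k
      = (x k.+1 - x k) * y k.+1 + x k * (y k.+1 - y k).
    by rewrite !fctE; ring.
  by apply: rpredD; [exact/dvdz_mulr/xc|exact/dvdz_mull/yc].
Qed.

HB.instance Definition _ :=
  GRing.isSubringClosed.Build (nat -> int) coherent coherent_subring_closed.

Record cohseq :=
  CohSeq { cohseq_val :> nat -> int ; cohseqP : cohseq_val \in coherent }.

HB.instance Definition _ := [isSub for cohseq_val].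
HB.instance Definition _ := [Choice of cohseq by <:].
HB.instance Definition _ := [SubChoice_isSubComNzRing of cohseq by <:].

Lemma cohseq_dvd (x : cohseq) i j : (i <= j)%N ->
  ((p ^ i)%N%:Z %| x i)%Z = ((p ^ i)%N%:Z %| x j)%Z.
Proof.
elim: j => [|j IH]; first by rewrite leqn0 => /eqP ->.
rewrite leq_eqVlt ltnS => /orP[/eqP -> //|ij]; rewrite IH //.
have /asboolP/(_ j) xc := cohseqP x.
have {}xc : ((p ^ i)%N%:Z %| x j.+1 - x j)%Z.
  by apply: dvdz_trans xc; rewrite dvdzE /= dvdn_exp2l.
by rewrite -[x j.+1](subrK (x j)) rpredDl.
Qed.

End CoherentSequences.

Section PadicIntegers.
Variables (p : nat) (p_pr : prime p).

Definition nullseq of prime p : {pred cohseq p} :=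
  fun x => `[< forall k, ((p ^ k)%N%:Z %| x k)%Z >].

Lemma nullseq_idealr_closed : idealr_closed (nullseq p_pr).
Proof.
split=> [||a x y /asboolP x0 /asboolP y0].
- by apply/asboolP => k; rewrite dvdz0.
- apply/negP => /asboolP /(_ 1%N); rewrite expn1 dvdzE /= => p1.
  by have := dvdn_leq (isT : 0 < 1)%N p1; rewrite leqNgt prime_gt1.
- by apply/asboolP => k; apply: rpredD; [exact/dvdz_mull/x0|exact: y0].
Qed.

Lemma nullseq_prime_closed : prime_idealr_closed (nullseq p_pr).
Proof.
move=> x y /asboolP xy0.
apply/negPn/negP; rewrite negb_or => /andP[/asboolPn x0 /asboolPn y0].
have [i xi] : exists i, ~~ ((p ^ i)%N%:Z %| x i)%Z.
  by apply: contrapT => /forallNP xn; apply: x0 => i; apply/negPn/negP/xn.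
have [j yj] : exists j, ~~ ((p ^ j)%N%:Z %| y j)%Z.
  by apply: contrapT => /forallNP yn; apply: y0 => j; apply/negPn/negP/yn.
move: xi yj (xy0 (i + j)%N).
rewrite (cohseq_dvd x (leq_addr j i)) (cohseq_dvd y (leq_addl i j)).
rewrite (_ : (x * y) _ = x (i + j)%N * y (i + j)%N) // !dvdzE !absz_nat abszM.
move: `|x _|%N `|y _|%N => a b.
have [->|a0] := posnP a; first by rewrite dvdn0.
have [->|b0] := posnP b; first by rewrite dvdn0.
rewrite !pfactor_dvdn ?muln_gt0 ?a0 // lognM // -!ltnNge => ai bj ab.
by have := leq_ltn_trans ab (leq_add ai (ltnW bj)); rewrite ltnn.
Qed.

HB.instance Definition _ :=
  isIdealr.Build (cohseq p) (nullseq p_pr) nullseq_idealr_closed.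
HB.instance Definition _ :=
  isPrimeIdealrClosed.Build (cohseq p) (nullseq p_pr) nullseq_prime_closed.

Definition padic_int := {ideal_quot (nullseq p_pr)}.

HB.instance Definition _ := GRing.ComNzRing.on padic_int.

(* The inverse is chosen classically, and is the identity outside the units. *)
Let padic_int_unit : {pred padic_int} :=
  fun x => `[< exists y : padic_int, y * x = 1 >].
Let padic_int_inv (x : padic_int) : padic_int := xget x [set y | y * x = 1].

Let padic_int_mulVr : {in padic_int_unit, left_inverse 1 padic_int_inv *%R}.
Proof.
by move=> x /asboolP [y yx]; rewrite /padic_int_inv; case: xgetP => [z _ //|/(_ y)].
Qed.

Let padic_int_unitPl (x y : padic_int) : y * x = 1 -> x \in padic_int_unit.
Proof. by move=> yx; apply/asboolP; exists y. Qed.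

Let padic_int_inv_out : {in [predC padic_int_unit], padic_int_inv =1 id}.
Proof.
move=> x /negP xn; rewrite /padic_int_inv; case: xgetP => // y _ yx.
by case: xn; exact: padic_int_unitPl yx.
Qed.

HB.instance Definition _ := GRing.ComNzRing_hasMulInverse.Build padic_int
  padic_int_mulVr padic_int_unitPl padic_int_inv_out.


HB.instance Definition _ :=
  GRing.ComUnitRing_isIntegral.Build padic_int
    (@Quotient.rquot_IdomainAxiom _ (nullseq p_pr)).

Definition padic := {fraction padic_int}.

HB.instance Definition _ := GRing.Field.copy padic {fraction padic_int}.

End PadicIntegers.

Section PadicTopology.
Variables (p : nat) (p_pr : prime p).
Local Notation K := (padic p_pr).

(* The ball x + p^k Z_p, of radius p^(-k). *)
Definition padic_ball (x : K) (k : int) : set K :=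
  [set y | exists z : padic_int p_pr, y = x + p%:R ^ k * FracField.tofrac z].

(* |x|_p = p^(-v) with v the largest k such that x is in p^k Z_p; the infimum
   also gives |0|_p = 0. *)
Definition padic_norm (R : realType) (x : K) : R :=
  inf [set p%:R ^ (- k) | k in [set k : int | padic_ball 0 k x]].

Let padic_open : set (set K) :=
  [set U | forall x, U x -> exists k : nat, padic_ball x k `<=` U].

Let padic_openT : padic_open setT.
Proof. by move=> x _; exists 0%N. Qed.

Let padic_ball_le (x : K) (i j : nat) : (i <= j)%N ->
  padic_ball x j `<=` padic_ball x i.
Proof.
move=> ij y [z ->]; exists (p%:R ^+ (j - i) * z).
by rewrite rmorphM rmorphXn rmorph_nat mulrA -exprD subnKC.
Qed.

Let padic_openI (A B : set K) : padic_open A -> padic_open B ->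
  padic_open (A `&` B).
Proof.
move=> oA oB x [/oA[i iA] /oB[j jB]]; exists (maxn i j) => y xy; split.
  by apply: iA; apply: padic_ball_le xy; rewrite leq_maxl.
by apply: jB; apply: padic_ball_le xy; rewrite leq_maxr.
Qed.

Let padic_open_bigU (I : Type) (f : I -> set K) :
  (forall i, padic_open (f i)) -> padic_open (\bigcup_i f i).
Proof.
move=> of_ x [i _ /of_[k kf]]; exists k => y /kf fy.
by exists i.
Qed.

HB.instance Definition _ := isPointed.Build K 0.
HB.instance Definition _ := isOpenTopological.Build K
  padic_openT padic_openI padic_open_bigU.

End PadicTopology.

Section Complex.
Variable R : realType.

Definition cexp (z : R[i]) : R[i] :=
  (expR (complex.Re z))%:C * (cos (complex.Im z) +i* sin (complex.Im z)).

(* t ^ a for t > 0; the value at t = 0 is only ever used on a null set. *)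
Definition cpow (t : R) (a : R[i]) : R[i] := cexp (a * (ln t)%:C).

Definition cintegral d (T : measurableType d) (mu : {measure set T -> \bar R})
    (D : set T) (f : T -> R[i]) : R[i] :=
  (\int[mu]_(x in D) complex.Re (f x)) +i* (\int[mu]_(x in D) complex.Im (f x)).

End Complex.

Section TestFunctions.
Variables (T : topologicalType) (V : zmodType).

Definition locally_constant (f : T -> V) :=
  forall x, \forall y \near x, f y = f x.

Definition test_function (f : T -> V) :=
  locally_constant f /\ compact (closure [set x | f x != 0]).

End TestFunctions.

Definition borel (T : ptopologicalType) := g_sigma_algebraType (@open T).

Section Vladimirov.
Variables (R : realType) (p : nat) (p_pr : prime p).
Local Notation C := R[i].
Local Notation K := (padic p_pr).
Local Notation norm := (@padic_norm p p_pr R).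

Definition unit_ball : set K := [set x | norm x <= 1].

Definition is_haar (mu : {measure set (borel K) -> \bar R}) :=
  (forall (x : K) (A : set K), measurable (A : set (borel K)) ->
    mu [set x + y | y in A] = mu A) /\ mu unit_ball = 1%E.

(* mun is the product measure dx_1 ... dx_n on the Borel sets of Q_p^n. *)
Definition is_power_measure n (mu : {measure set (borel K) -> \bar R})
    (mun : {measure set (borel 'rV[K]_n) -> \bar R}) :=
  forall A : 'I_n -> set K, (forall i, measurable (A i : set (borel K))) ->
    mun [set x : 'rV[K]_n | forall i, A i (x 0 i)] = (\prod_(i < n) mu (A i))%E.

(* The representative of x modulo Z_p of the form m / p^k in [0, 1[. *)
Definition fracpart (x : K) : R :=
  xget 0 [set r | exists m k : nat, [/\ (m < p ^ k)%N,
    r = m%:R / p%:R ^+ k & unit_ball (x - m%:R / p%:R ^+ k)]].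

Section Fourier.
Variable n : nat.

Definition padic_char (xi x : 'rV[K]_n) : C :=
  cexp ('i * (2 * pi * \sum_(j < n) fracpart (xi 0 j * x 0 j))%:C).

Definition fourier (mun : {measure set (borel 'rV[K]_n) -> \bar R})
    (phi : 'rV[K]_n -> C) (xi : 'rV[K]_n) : C :=
  cintegral mun setT (fun x => padic_char xi x * phi x).

Definition lizorkin_Psi : set ('rV[K]_n -> C) :=
  [set psi | test_function psi /\
    forall (j : 'I_n) (xi : 'rV[K]_n), xi 0 j = 0 -> psi xi = 0].

Definition lizorkin_Phi (mun : {measure set (borel 'rV[K]_n) -> \bar R}) :
    set ('rV[K]_n -> C) :=
  fourier mun @` lizorkin_Psi.

End Fourier.

Section Riesz.
Variable mu : {measure set (borel K) -> \bar R}.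

Definition riesz_pole (j : int) : C :=
  (2 * pi)%:C * 'i / (ln p%:R)%:C * j%:~R.

Definition padic_Gamma (a : C) : C :=
  (1 - cpow p%:R (a - 1)) / (1 - cpow p%:R (- a)).

Definition norm_power (a : C) (phi : K -> C) : C :=
  cintegral mu unit_ball (fun z => cpow (norm z) (a - 1) * (phi z - phi 0))
  + cintegral mu (~` unit_ball) (fun z => cpow (norm z) (a - 1) * phi z)
  + phi 0 * ((1 - p%:R^-1) / (1 - cpow p%:R (- a))).

Definition riesz (a : C) (phi : K -> C) : C :=
  if `[< exists j, a = riesz_pole j >] then phi 0
  else if `[< exists j, a = 1 + riesz_pole j >] then
    cintegral mu setT (fun z =>
      (- ((1 - p%:R^-1) / ln p%:R) * ln (norm z))%:C * phi z)
  else norm_power a phi / padic_Gamma a.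

(* <f(x) x g(y), phi> = <f(x), <g(y), phi(x, y)>>, iterated. *)
Fixpoint direct_product n : ('I_n -> (K -> C) -> C) -> ('rV[K]_n -> C) -> C :=
  if n is n'.+1 then fun f phi =>
    f ord0 (fun z : K => direct_product (fun i : 'I_n' => f (lift ord0 i))
      (fun y : 'rV[K]_n' => phi (row_mx (const_mx z : 'rV[K]_1) y)))
  else fun _ phi => phi 0.

Definition multi_riesz n (alpha : 'I_n -> C) : ('rV[K]_n -> C) -> C :=
  direct_product (fun i => riesz (alpha i)).

Definition vladimirov n (alpha : 'I_n -> C) (phi : 'rV[K]_n -> C)
    (x : 'rV[K]_n) : C :=
  multi_riesz (fun i => - alpha i) (fun xi => phi (x - xi)).

End Riesz.
End Vladimirov.

(* Main.v *)
(** The Fourier transform turns the convolution with [f_(- alpha)] into the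
    multiplication by [prod_i |xi_i|^(alpha_i)], which is a bijection of
    [Psi]: a [psi] in [Psi] vanishes near the axes, so the multiplier is locally
    constant and nonzero on its support, and the multiplier of [- alpha] is
    its inverse.

    To make this rigorous with finite sums only, write [psi], which is invariant
    under [p^k Z_p^n] for some [k], as a combination of indicators of boxes
    [c + p^k Z_p^n] that avoid the axes. The Fourier transform of such an
    indicator is a product of one-dimensional functions
    [x |-> chi (c_i x) 1_(|x| <= p^k)] with [|c_i| > p^(-k)], and these are
    eigenvectors of the convolution with [f_s], for the eigenvalue [|c_i|^(-s)].
    For this eigenvector property, only the sphere values [w j] of the kernel and
    its masses [T j] on the balls [p^j Z_p] matter: since [chi (c_i x)] has zero
    integral on the balls [p^j Z_p] of radius larger than [1 / |c_i|], the pairing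
    telescopes to [T (- m) - p^m w (- m - 1)] with [m] the valuation of [c_i]. *)

From HB Require Import structures.
Require Import Defs.
From mathcomp Require Import all_boot all_order all_algebra.
From mathcomp Require Import fraction ring_quotient generic_quotient complex.
From mathcomp Require Import ring lra zify.
From mathcomp Require Import all_classical all_reals all_analysis.
From mathcomp Require Import measurable_realfun.

Set Implicit Arguments.
Unset Strict Implicit.
Unset Printing Implicit Defensive.

Import Order.TTheory GRing.Theory Num.Theory numFieldNormedType.Exports.
Local Open Scope complex_scope.
Local Open Scope classical_set_scope.
Local Open Scope ring_scope.

(** * Arithmetic of p-adic integers *)

(** The integral of the library has a value for every function but is additive only on integrable
    ones, so [has_cintegral] carries integrability along with the value. This is cheap for finite
    combinations of indicators of balls, one reason to reduce everything to finite sums. Only the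
    logarithmic kernel resists: it is integrated up to the origin, where it takes infinitely many
    values, and its mass there needs a series.

    The kernel [f_s] has three definitions, according to the poles. [kernel_integral] gives them a
    common shape: sphere values [w] away from a small ball and, on that ball, where the test
    function is constant, the mass [T] times [phi 0]. Linearity and the eigenvector property are
    then proved once for all [s]. The relation [kernel_mass] makes the shape independent of the size
    of the small ball. The factor [padic_Gamma] is what frees the eigenvalue [|c|^(-s)] of any
    constant, so that the delta and the logarithm, at the exceptional [s], obey the same formula. *)

Section PadicIntegerArithmetic.
Variables (p : nat) (p_pr : prime p).
Implicit Types (x y : cohseq p) (k : nat) (z : padic_int p_pr).

Local Notation pi x := (\pi_(padic_int p_pr)%qT x).

Lemma cohseq_step x k : ((p ^ k)%N%:Z %| x k.+1 - x k)%Z.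
Proof. by have /asboolP := cohseqP x. Qed.

Lemma cohseq_sub_dvd x i j : (i <= j)%N -> ((p ^ i)%N%:Z %| x j - x i)%Z.
Proof.
elim: j => [|j IH]; first by rewrite leqn0 => /eqP ->; rewrite subrr dvdz0.
rewrite leq_eqVlt ltnS => /orP[/eqP ->|ij]; first by rewrite subrr dvdz0.
rewrite -(subrKA (x j)) rpredD ?IH //.
by apply: dvdz_trans (cohseq_step x j); rewrite dvdzE /= dvdn_exp2l.
Qed.

Lemma cohseq_nat m k : (m%:R : cohseq p) k = m%:R.
Proof. by elim: m => [//|m IH]; rewrite !mulrS -IH. Qed.

Lemma cohseqM x y k : (x * y) k = x k * y k. Proof. by []. Qed.

Lemma padic_int_eqP x y :
  reflect (forall k, ((p ^ k)%N%:Z %| x k - y k)%Z) (pi x == pi y).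
Proof.
rewrite -Quotient.idealrBE; apply: (iffP idP) => [/asboolP //|H].
exact/asboolP.
Qed.

Lemma padic_int_repr z : exists x, z = pi x.
Proof. by exists (repr z); rewrite reprK. Qed.

Lemma padic_int_piD x y : pi (x + y) = pi x + pi y. Proof. exact: rmorphD. Qed.
Lemma padic_int_piM x y : pi (x * y) = pi x * pi y. Proof. exact: rmorphM. Qed.
Lemma padic_int_pi_nat m : pi m%:R = m%:R. Proof. exact: rmorph_nat. Qed.

Lemma padic_int_expn k : (p%:R : padic_int p_pr) ^+ k = pi ((p ^ k)%N%:R).
Proof. by rewrite padic_int_pi_nat natrX. Qed.

(** Dividing by [p^k] costs [k] digits of precision, so the quotient reads the sequence [k] places
    further. The explicit terms of [y] are kept because its first term decides whether the quotient
    is a unit. *)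
Lemma padic_int_divpX x k : ((p ^ k)%N%:Z %| x k)%Z ->
  exists y : cohseq p, pi x = p%:R ^+ k * pi y /\
    forall i, y i * (p ^ k)%N%:Z = x (i + k)%N.
Proof.
move=> xk; have p0 : (p ^ k)%N%:Z != 0.
  by rewrite eqz_nat expn_eq0 -leqn0 leqNgt prime_gt0.
have dv i : ((p ^ k)%N%:Z %| x (i + k)%N)%Z.
  by rewrite -[x _](subrK (x k)) rpredD // cohseq_sub_dvd // leq_addl.
pose f i := (x (i + k)%N %/ (p ^ k)%N%:Z)%Z.
have fE i : f i * (p ^ k)%N%:Z = x (i + k)%N by rewrite /f divzK.
have fP : f \in coherent p.
  apply/asboolP => i; have := cohseq_step x (i + k)%N.
  by rewrite -addSn -!fE -mulrBl expnD PoszM dvdz_mul2r // (negPf p0).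
exists (CohSeq fP); split => //.
apply/eqP; rewrite padic_int_expn -padic_int_piM; apply/padic_int_eqP => i.
rewrite cohseqM cohseq_nat mulrC natz fE -opprB dvdzE abszN -dvdzE.
by apply: cohseq_sub_dvd; rewrite leq_addr.
Qed.

Lemma padic_int_residue z k :
  exists m, (m < p ^ k)%N /\ exists z', z = m%:R + p%:R ^+ k * z'.
Proof.
have [x ->] := padic_int_repr z.
have p0 : (0 < p ^ k)%N by rewrite expn_gt0 prime_gt0.
have p0' : (p ^ k)%N%:Z != 0 by rewrite eqz_nat -lt0n.
pose m := `|(x k %% (p ^ k)%N%:Z)%Z|%N.
have mE : (m%:Z = (x k %% (p ^ k)%N%:Z)%Z) by rewrite gez0_abs // modz_ge0.
exists m; split.
  by rewrite -ltz_nat mE; have := ltz_mod (x k) p0'; rewrite ger0_norm.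
have /padic_int_divpX[y [yE _]] : ((p ^ k)%N%:Z %| (x - m%:R) k)%Z.
  have -> : (x - m%:R) k = x k - m%:Z by rewrite -[m%:Z]natz -(cohseq_nat _ k).
  by rewrite mE -eqz_mod_dvd modz_mod.
exists (pi y); rewrite -yE -padic_int_pi_nat -padic_int_piD.
by congr (\pi_(_)%qT _); rewrite addrC subrK.
Qed.

Lemma padic_int_nat_dvd m k z : m%:R = p%:R ^+ k * z -> (p ^ k %| m)%N.
Proof.
have [x ->] := padic_int_repr z.
rewrite padic_int_expn -padic_int_piM -padic_int_pi_nat => /eqP/padic_int_eqP.
move=> /(_ k).
rewrite cohseqM !cohseq_nat !natz => H.
have : ((p ^ k)%N%:Z %| m%:Z)%Z.
  by rewrite -[m%:Z](subrK ((p ^ k)%N%:Z * x k)) rpredD // dvdz_mulr.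
by rewrite dvdzE.
Qed.

Lemma padic_int_p_neq0 : p%:R != 0 :> padic_int p_pr.
Proof.
apply/eqP => p0; have /(padic_int_nat_dvd (k := 2)) : p%:R = p%:R ^+ 2 * (0 : padic_int p_pr).
  by rewrite mulr0.
move/(dvdn_leq (prime_gt0 p_pr)); have := prime_gt1 p_pr; nia.
Qed.

(** Each term is prime to [p], hence invertible modulo [p^k] by Bezout; inverses modulo [p^k] are
    unique, so any choice of them is coherent. *)
Lemma cohseq_unit x : ~~ (p%:Z %| x 1%N)%Z -> exists z, z * pi x = 1.
Proof.
move=> x1.
have cop k : coprimez (x k) (p ^ k)%N%:Z.
  rewrite coprimezE /=; case: k => [|k]; first by rewrite expn0 coprimen1.
  rewrite coprimeXr // coprime_sym prime_coprime //.
  apply: contra x1 => xk0; have xk : (p%:Z %| x k.+1)%Z by rewrite dvdzE.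
  rewrite -[x 1%N](subKr (x k.+1)) rpredB //.
  by have := @cohseq_sub_dvd x 1 k.+1 isT; rewrite expn1.
have /choice[f fE] k : exists u : int, ((p ^ k)%N%:Z %| u * x k - 1)%Z.
  have /coprimezP[[u w] /= uw] := cop k; exists u.
  by rewrite -uw opprD addrA subrr sub0r dvdzE abszN -dvdzE dvdz_mull.
have fP : f \in coherent p.
  (* Divisibility by [p^k] may be tested after multiplication by [x k], which is coprime to it. *)
  apply/asboolP => k; rewrite -(Gauss_dvdzr (n := x k)); last first.
    by rewrite coprimez_sym.
  have -> : x k * (f k.+1 - f k) =
     (f k.+1 * x k.+1 - 1) - (f k * x k - 1) - f k.+1 * (x k.+1 - x k) by ring.
  apply: rpredB; last exact/dvdz_mull/cohseq_step.
  apply: rpredB; last exact: fE.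
  by apply: dvdz_trans (fE k.+1); rewrite dvdzE /= dvdn_exp2l.
exists (pi (CohSeq fP)); rewrite -padic_int_piM -[1]/(1%:R) -padic_int_pi_nat.
by apply/eqP/padic_int_eqP => k; rewrite cohseq_nat; exact: fE.
Qed.

Lemma padic_int_factor z : z != 0 ->
  exists k u w, z = p%:R ^+ k * u /\ w * u = 1.
Proof.
have [x ->] := padic_int_repr z => x0.
have ex : exists k, ~~ ((p ^ k)%N%:Z %| x k)%Z.
  apply: contrapT => /forallNP xn; case/eqP: x0.
  rewrite -[RHS](padic_int_pi_nat 0); apply/eqP/padic_int_eqP => k.
  by rewrite subr0; apply/negPn/negP/xn.
(* The valuation is one less than the first index at which divisibility fails; index 0 never
   fails. *)
case: (ex_minnP ex) => -[|k]; first by rewrite expn0 dvdzE dvd1n.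
move=> xk1 kmin.
have xk : ((p ^ k)%N%:Z %| x k)%Z.
  by apply/negPn/negP => /kmin; rewrite ltnn.
have [y [-> yE]] := padic_int_divpX xk.
have [w wy] : exists w, w * pi y = 1.
  apply: cohseq_unit; apply: contra xk1; have := yE 1%N; rewrite add1n => <-.
  by rewrite expnS PoszM dvdz_mul2r // eqz_nat expn_eq0 -leqn0 leqNgt prime_gt0.
by exists k, (pi y), w.
Qed.

End PadicIntegerArithmetic.

(** * Balls, valuation and norm *)

Lemma fraction_ex (A : idomainType) (x : {fraction A}) :
  exists a b : A, b != 0 /\ x * FracField.tofrac b = FracField.tofrac a.
Proof.
elim/quotW: x => r; exists (frac r).1, (frac r).2; split.
  exact: denom_ratioP.
unlock FracField.tofrac; rewrite -[LHS]FracField.pi_mul.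
apply/eqmodP; rewrite /= FracField.equivfE /FracField.mulf.
by rewrite !numden_Ratio ?oner_eq0 ?mulf_neq0 ?denom_ratioP ?oner_eq0 // !mulr1 mulrC.
Qed.

(* Otherwise [done] may try to decide equalities of fractions by computation. *)
Opaque FracField.add FracField.opp FracField.mul FracField.inv FracField.tofrac.

Section PadicBalls.
Variables (p : nat) (p_pr : prime p).
Local Notation K := (padic p_pr).
Local Notation Z := (padic_int p_pr).

Definition padic_of_int (z : Z) : K := FracField.tofrac z.
Local Notation iota := padic_of_int.

Fact padic_of_int_zmod_morphism : zmod_morphism iota.
Proof. exact: (rmorphB (@FracField.tofrac Z)). Qed.
Fact padic_of_int_monoid_morphism : monoid_morphism iota.
Proof. exact: tofrac_is_monoid_morphism. Qed.

HB.instance Definition _ :=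
  GRing.isZmodMorphism.Build Z K iota padic_of_int_zmod_morphism.
HB.instance Definition _ :=
  GRing.isMonoidMorphism.Build Z K iota padic_of_int_monoid_morphism.

Lemma padic_of_int_inj : injective iota.
Proof. by move=> a b /eqP; rewrite tofrac_eq => /eqP. Qed.

Lemma padic_of_int_neq0 z : z != 0 -> iota z != 0.
Proof. by rewrite -(inj_eq padic_of_int_inj) rmorph0. Qed.

Lemma padic_fraction_ex (x : K) :
  exists a b : Z, b != 0 /\ x * iota b = iota a.
Proof. exact: fraction_ex. Qed.

Local Notation B k x := (@padic_ball p p_pr 0 k x).
Implicit Types (x y : K) (j k l : int).

Lemma padic_p_neq0 : p%:R != 0 :> K.
Proof. by rewrite -(rmorph_nat iota) padic_of_int_neq0 // padic_int_p_neq0. Qed.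

Lemma padic_powD j k : p%:R ^ (j + k) = p%:R ^ j * p%:R ^ k :> K.
Proof. by rewrite expfzDr // padic_p_neq0. Qed.

Lemma ballP k x : B k x <-> exists z, x = p%:R ^ k * iota z.
Proof. by split=> -[z ->]; exists z; rewrite add0r. Qed.

Lemma padic_ballE x k y : padic_ball x k y <-> B k (y - x).
Proof.
split=> [[z ->]|/ballP[z yx]]; first by exists z; rewrite add0r addrC addKr.
by exists z; rewrite -yx addrC subrK.
Qed.

Lemma ball0 k : B k 0.
Proof. by apply/ballP; exists 0; rewrite rmorph0 mulr0. Qed.

Lemma ballD k x y : B k x -> B k y -> B k (x + y).
Proof.
by move=> /ballP[a ->] /ballP[b ->]; apply/ballP; exists (a + b);
  rewrite rmorphD mulrDr.
Qed.

Lemma ballN k x : B k x -> B k (- x).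
Proof. by move=> /ballP[a ->]; apply/ballP; exists (- a); rewrite rmorphN mulrN. Qed.

Lemma ballB k x y : B k x -> B k y -> B k (x - y).
Proof. by move=> xk yk; apply: ballD => //; exact: ballN. Qed.

Lemma ballBC k x y : B k (x - y) -> B k (y - x).
Proof. by move=> /ballN; rewrite opprB. Qed.

Lemma ballDr k x y : B k x -> B k (x + y) <-> B k y.
Proof.
by move=> xk; split=> [xyk|]; [rewrite -(addKr x y) addrC; apply: ballB|exact: ballD].
Qed.

Lemma ballM j k x y : B j x -> B k y -> B (j + k) (x * y).
Proof.
move=> /ballP[a ->] /ballP[b ->]; apply/ballP; exists (a * b).
by rewrite rmorphM padic_powD mulrACA.
Qed.

Lemma ballMl k x y : B k x -> B 0 y -> B k (x * y).
Proof. by move=> xk y0; have := ballM xk y0; rewrite addr0. Qed.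

Lemma ballMr k x y : B 0 x -> B k y -> B k (x * y).
Proof. by move=> xk y0; have := ballM xk y0; rewrite add0r. Qed.

Lemma ball_pow k : B k (p%:R ^ k).
Proof. by apply/ballP; exists 1; rewrite rmorph1 mulr1. Qed.

Lemma ball_nat m : B 0 m%:R.
Proof. by apply/ballP; exists m%:R; rewrite rmorph_nat expr0z mul1r. Qed.

Lemma ball_scale j k x : B k (p%:R ^ j * x) <-> B (k - j) x.
Proof.
split=> [/(ballM (ball_pow (- j)))|/(ballM (ball_pow j))]; last by rewrite addrC subrK.
by rewrite addrC mulrA -padic_powD addNr expr0z mul1r.
Qed.

Lemma ball_le j k x : j <= k -> B k x -> B j x.
Proof.
move=> jk /ballP[z ->]; apply/ballP; exists (p%:R ^+ `|k - j|%N * z).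
rewrite rmorphM rmorphXn rmorph_nat mulrA exprnP -padic_powD.
by congr (p%:R ^ _ * _); lia.
Qed.

Lemma ball_residue l (r : nat) x : B l x ->
  exists m, (m < p ^ r)%N /\ B (l + r%:Z) (x - p%:R ^ l * m%:R).
Proof.
move=> /ballP[z ->]; have [m [mr [z' ->]]] := padic_int_residue z r.
exists m; split=> //; apply/ballP; exists z'.
rewrite rmorphD rmorph_nat mulrDr addrC addKr rmorphM rmorphXn rmorph_nat.
by rewrite padic_powD mulrA.
Qed.

Lemma ball_nat_dvd (k m : nat) : B k m%:R <-> (p ^ k %| m)%N.
Proof.
split=> [/ballP[z]|/dvdnP[q ->]].
  move=> mz; apply: (@padic_int_nat_dvd p p_pr _ _ z).
  by apply: padic_of_int_inj; rewrite rmorph_nat mz rmorphM rmorphXn rmorph_nat.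
rewrite natrM natrX -[k%:Z]add0r; apply: ballM; [exact: ball_nat|exact: ball_pow].
Qed.

Lemma ball_p k j : B k (p%:R ^ j) <-> k <= j.
Proof.
split=> [|jk]; last exact: ball_le (ball_pow j).
rewrite -[_ ^ j]mulr1 => /ball_scale b1; rewrite leNgt; apply/negP => jk.
have : B 1 (1%:R : K) by apply: ball_le b1; lia.
by rewrite (ball_nat_dvd 1) expn1 dvdn1 => /eqP p1; move: p_pr; rewrite p1.
Qed.

(** Numerator and denominator are powers of [p] times units, and units do not affect membership in
    balls. The statement includes the inverse because the same units settle it. *)
Lemma padic_valuation_ex x : x != 0 ->
  exists v, (forall k, B k x <-> k <= v) /\ (forall k, B k x^-1 <-> k <= - v).
Proof.
move=> x0; have [a [b [b0 xab]]] := padic_fraction_ex x.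
have a0 : a != 0.
  apply: contra_neq x0 => a0; apply: (mulIf (padic_of_int_neq0 b0)).
  by rewrite xab a0 rmorph0 mul0r.
have [i [u [u' [aE uu']]]] := padic_int_factor a0.
have [j [w [w' [bE ww']]]] := padic_int_factor b0.
have invE (c c' : Z) : c' * c = 1 -> (iota c)^-1 = iota c' /\ iota c != 0.
  move=> cc; have cc1 : iota c' * iota c = 1 by rewrite -rmorphM cc rmorph1.
  have c0 : iota c != 0.
    by apply: contra_eq_neq cc1 => ->; rewrite mulr0 eq_sym oner_neq0.
  by split=> //; apply: (mulIf c0); rewrite mulVf.
have [uV u0] := invE _ _ uu'; have [wV w0] := invE _ _ ww'.
pose v := i%:Z - j%:Z.
have xE : x = p%:R ^ v * (iota u * iota w').
  apply: (mulIf (padic_of_int_neq0 b0)).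
  rewrite xab aE bE !rmorphM !rmorphXn !rmorph_nat -wV.
  rewrite mulrACA mulfVK // !exprnP -padic_powD.
  by congr (_ ^ _ * _); rewrite /v; lia.
have Bt z : B 0 (iota z) by apply/ballP; exists z; rewrite expr0z mul1r.
have gen (y y' : K) k : B 0 y -> B 0 y' -> y * y' = 1 ->
    forall e, B k (p%:R ^ e * y) <-> k <= e.
  move=> yB y'B yy e; rewrite -ball_p; split=> [H|H].
    have -> : p%:R ^ e = p%:R ^ e * y * y' by rewrite -mulrA yy mulr1.
    exact: ballMl.
  exact: ballMl.
have B1 : B 0 (iota u * iota w') by exact: ballMl.
have B2 : B 0 (iota w * iota u') by exact: ballMl.
have e12 : iota u * iota w' * (iota w * iota u') = 1.
  by rewrite -uV -wV mulrA (mulfVK w0) (mulfV u0).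
exists v; split=> k; first by rewrite xE; exact: gen e12 _.
have -> : x^-1 = p%:R ^ (- v) * (iota w * iota u').
  apply: (mulIf x0); rewrite (mulVf x0) xE mulrACA -padic_powD addNr.
  by rewrite expr0z mul1r mulrC e12.
by apply: gen B2 B1 _ _; rewrite mulrC.
Qed.

(* Arbitrary at [x = 0]. *)
Definition pval x : int := xget 0 [set v | (forall k, B k x <-> k <= v) /\
  (forall k, B k x^-1 <-> k <= - v)].

Lemma pvalP x k : x != 0 -> B k x <-> k <= pval x.
Proof.
move=> /padic_valuation_ex[v vP]; rewrite /pval.
by case: xgetP => [w _ [wP _]|/(_ v)]; [exact: wP|].
Qed.

Lemma pvalV x : x != 0 -> B (- pval x) x^-1.
Proof.
move=> /padic_valuation_ex[v vP]; rewrite /pval.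
by case: xgetP => [w _ [_ wP]|/(_ v)]; [exact/wP|].
Qed.

Lemma pval_unique x v : x != 0 -> B v x -> ~ B (v + 1) x -> pval x = v.
Proof.
by move=> x0; rewrite !pvalP // => vx /negP; rewrite -ltNge; lia.
Qed.

Lemma ballN_neq0 k x : ~ B k x -> x != 0.
Proof. by move=> nx; apply/eqP => x0; apply: nx; rewrite x0; exact: ball0. Qed.

(** Ultrametric rigidity: a perturbation smaller than [x] does not change its size. Hence [|x|] is
    constant on every ball that misses the origin. *)
Lemma pval_congr k x y : ~ B k x -> B k (y - x) -> pval y = pval x.
Proof.
move=> nx yx; have x0 := ballN_neq0 nx.
have yE : y = (y - x) + x by rewrite subrK.
have y0 : y != 0.
  apply: (@ballN_neq0 k); move=> yk; apply: nx.
  by rewrite -(subKr y x); apply: ballB.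
have vk : pval x < k by rewrite ltNge; apply/negP => /(pvalP k x0).
apply: pval_unique => //; rewrite yE.
  by apply: ballD; [apply: ball_le yx; lia|rewrite pvalP].
have yx1 : B (pval x + 1) (y - x) by apply: ball_le yx; lia.
move=> yB; have := iffLR (pvalP _ x0) (iffLR (ballDr x yx1) yB).
by rewrite gerDl.
Qed.

Lemma ball_ex x : exists k, B k x.
Proof.
have [->|x0] := eqVneq x 0; first by exists 0; exact: ball0.
by exists (pval x); rewrite pvalP.
Qed.

Lemma padic_ball_inter0 x : (forall k, B k x) -> x = 0.
Proof.
move=> xB; apply/eqP; apply: contrapT => /negP x0.
by have := xB (pval x + 1); rewrite pvalP //; lia.
Qed.

Section Norm.
Variable R : realType.
Local Notation norm := (@padic_norm p p_pr R).

Let p_gt0 : (0 : R) < p%:R. Proof. by rewrite ltr0n prime_gt0. Qed.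
Let p_gt1 : (1 : R) < p%:R. Proof. by rewrite ltr1n prime_gt1. Qed.

Lemma padic_normE x : x != 0 -> norm x = p%:R ^ (- pval x).
Proof.
move=> x0; apply/eqP; rewrite eq_le; apply/andP; split.
  apply: ge_inf; last by exists (pval x) => //=; rewrite pvalP.
  by exists 0 => _ [k _ <-]; rewrite exprz_ge0 // ltW.
apply: lb_le_inf; first by exists (p%:R ^ (- pval x)), (pval x) => //=; rewrite pvalP.
by move=> _ [k /= /(pvalP k x0) kx <-]; rewrite ler_eXz2l // lerN2 kx.
Qed.

Lemma padic_pow_small (e : R) : 0 < e -> exists k : nat, (p%:R ^+ k)^-1 <= e.
Proof.
move=> e0; exists (Num.bound e^-1); rewrite invf_ple ?posrE ?exprn_gt0 //.
apply: le_trans (ltW (archi_boundP _)) _; first by rewrite invr_ge0 ltW.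
rewrite -natrX ler_nat; apply: ltnW; apply: ltn_expl; exact: prime_gt1.
Qed.

Lemma padic_norm0 : norm 0 = 0.
Proof.
apply/eqP; rewrite eq_le; apply/andP; split; last first.
  apply: lb_le_inf; first by exists (p%:R ^ (- 0)), 0 => //=; exact: ball0.
  by move=> _ [k _ <-]; rewrite exprz_ge0 // ltW.
apply/ler_addgt0Pr => e e0; rewrite add0r.
have [k ke] := padic_pow_small e0.
apply: le_trans ke; apply: ge_inf; last by exists k%:Z; [exact: ball0|rewrite exprnN].
by exists 0 => _ [j _ <-]; rewrite exprz_ge0 // ltW.
Qed.

Lemma unit_ballE : @unit_ball R p p_pr = [set x | B 0 x].
Proof.
apply/seteqP; split=> x /=; rewrite /unit_ball /=.
  have [->|x0] := eqVneq x 0; first by rewrite padic_norm0 => _; exact: ball0.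
  by rewrite padic_normE // -(expr0z (p%:R : R)) ler_eXz2l // pvalP //; lia.
have [->|x0] := eqVneq x 0; first by rewrite padic_norm0.
by rewrite padic_normE // pvalP // -(expr0z (p%:R : R)) ler_eXz2l //; lia.
Qed.

Lemma ln_padic_norm x : x != 0 -> ln (norm x) = - (pval x)%:~R * ln p%:R.
Proof.
move=> x0; rewrite padic_normE // -mulrNz; case: (- pval x) => k.
  by rewrite -exprnP lnXn // mulr_natl.
by rewrite NegzE -exprnN lnV ?posrE ?exprn_gt0 // lnXn // mulrNz mulNr mulr_natl.
Qed.

End Norm.
End PadicBalls.

(** * Complex exponential and complex integrals *)

Section ComplexExponential.
Variable R : realType.
Implicit Types (w z : R[i]) (t : R) (k : int).

Lemma complex_eqP w z :
  complex.Re w = complex.Re z -> complex.Im w = complex.Im z -> w = z.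
Proof. by case: w z => [a b] [c d] /= -> ->. Qed.

Lemma ReD w z : complex.Re (w + z) = complex.Re w + complex.Re z.
Proof. by case: w z => [a b] [c d]. Qed.

Lemma ImD w z : complex.Im (w + z) = complex.Im w + complex.Im z.
Proof. by case: w z => [a b] [c d]. Qed.

Lemma ReM w z : complex.Re (w * z) =
  complex.Re w * complex.Re z - complex.Im w * complex.Im z.
Proof. by case: w z => [a b] [c d]. Qed.

Lemma ImM w z : complex.Im (w * z) =
  complex.Re w * complex.Im z + complex.Im w * complex.Re z.
Proof. by case: w z => [a b] [c d]. Qed.

Lemma cexpE w : cexp w =
  (expR (complex.Re w) * cos (complex.Im w)) +i*
  (expR (complex.Re w) * sin (complex.Im w)).
Proof. by rewrite /cexp; apply: complex_eqP; rewrite ?ReM ?ImM /=; ring. Qed.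

Lemma cexp0 : cexp 0 = 1 :> R[i].
Proof. by rewrite cexpE /= expR0 cos0 sin0; apply: complex_eqP => /=; ring. Qed.

Lemma cexpD w z : cexp (w + z) = cexp w * cexp z.
Proof.
rewrite !cexpE ReD ImD expRD cosD sinD.
by apply: complex_eqP; rewrite ?ReM ?ImM /=; ring.
Qed.

Lemma cexpNK w : cexp w * cexp (- w) = 1.
Proof. by rewrite -cexpD subrr cexp0. Qed.

Lemma cexp_neq0 w : cexp w != 0.
Proof. by apply: contra_eq_neq (cexpNK w) => ->; rewrite mul0r eq_sym oner_neq0. Qed.

Lemma cexpN w : cexp (- w) = (cexp w)^-1.
Proof. by apply: (mulfI (cexp_neq0 w)); rewrite cexpNK mulfV ?cexp_neq0. Qed.

Lemma cexpMn w n : cexp (w *+ n) = cexp w ^+ n.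
Proof. by elim: n => [|n IH]; rewrite ?cexp0 // mulrS cexpD IH exprS. Qed.

Lemma cexpMz w k : cexp (w *~ k) = cexp w ^ k.
Proof.
by case: k => n; rewrite ?cexpMn // NegzE mulrNz cexpN cexpMn exprnN.
Qed.

Lemma cexp_sum (I : finType) (F : I -> R[i]) :
  cexp (\sum_i F i) = \prod_i cexp (F i).
Proof. exact: (big_morph _ cexpD cexp0). Qed.

Lemma cexp_2pi : cexp ('i * (2 * pi)%:C) = 1 :> R[i].
Proof.
rewrite cexpE; have -> : 'i * (2 * pi)%:C = 0 +i* (2 * pi) :> R[i].
  by apply: complex_eqP; rewrite ?ReM ?ImM /=; ring.
rewrite /= mulr_natl cos2pi sin2pi expR0.
by apply: complex_eqP => /=; ring.
Qed.

Lemma cexp_2pi_int k : cexp ('i * (2 * pi * k%:~R)%:C) = 1 :> R[i].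
Proof.
by rewrite rmorphM rmorph_int mulrA mulrzr cexpMz cexp_2pi exp1rz.
Qed.

Lemma cos_eq1 t : 0 <= t < 2 * pi -> cos t = 1 -> t = 0.
Proof.
move=> /andP[t0 t2] ct; have p0 := pi_ge0 R.
have [tp|tp] := leP t pi.
  apply: cos_inj; rewrite ?in_itv /= ?t0 ?lexx ?p0 //; by rewrite cos0.
(* The cosine is injective only up to [pi], so the second half period is reflected onto the
   first. *)
have : 2 * pi - t = 0.
  apply: cos_inj; rewrite ?in_itv /=; [lra|lra|].
  rewrite cos0 -[RHS]ct -[RHS]cosN -[RHS]cosD2pi; congr cos; ring.
lra.
Qed.

(** The kernel of the exponential is needed twice: to see that [chi] is nontrivial, and that the
    factors of [padic_Gamma] vanish only at the excluded poles. *)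
Lemma cexp_eq1 w : cexp w = 1 -> exists k, w = 'i * (2 * pi * k%:~R)%:C.
Proof.
move=> w1; have p0 := pi_gt0 R.
have w1R : expR (complex.Re w) * cos (complex.Im w) = 1.
  by have := congr1 (@complex.Re R) w1; rewrite cexpE.
have w1I : expR (complex.Re w) * sin (complex.Im w) = 0.
  by have := congr1 (@complex.Im R) w1; rewrite cexpE.
have re0 : complex.Re w = 0.
  have : expR (complex.Re w) ^+ 2 = 1.
    rewrite -[LHS]mulr1 -[X in _ * X = _](cos2Dsin2 (complex.Im w)).
    transitivity ((expR (complex.Re w) * cos (complex.Im w)) ^+ 2 +
      (expR (complex.Re w) * sin (complex.Im w)) ^+ 2); first by ring.
    by rewrite w1R w1I; ring.
  by rewrite -expRM_natl -[RHS]expR0 => /expR_inj; lra.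
move: w1R; rewrite re0 expR0 mul1r => c1.
pose k := Num.floor (complex.Im w / (2 * pi)).
pose r := complex.Im w - 2 * pi * k%:~R.
have r0 : r = 0.
  apply: cos_eq1.
    have /andP[k1 k2] := floor_itv (complex.Im w / (2 * pi)).
    move: k1 k2; rewrite ler_pdivlMr ?mulr_gt0 // ltr_pdivrMr ?mulr_gt0 //.
    by rewrite intrD /r -/k => k1 k2; lra.
  have cE (v : R) : cos v = complex.Re (cexp ('i * v%:C)).
    rewrite cexpE; have -> : 'i * v%:C = 0 +i* v :> R[i].
      by apply: complex_eqP; rewrite ?ReM ?ImM /=; ring.
    by rewrite /= expR0 mul1r.
  rewrite cE /r rmorphB mulrBr cexpD cexpN cexp_2pi_int invr1 mulr1 -cE.
  exact: c1.
exists k; apply: complex_eqP; rewrite ?ReM ?ImM /=; rewrite ?re0; first by ring.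
by move: r0; rewrite /r => r0; lra.
Qed.

End ComplexExponential.

Section ComplexIntegral.
Variables (d : measure_display) (T : measurableType d) (R : realType).
Variable mu : {measure set T -> \bar R}.
Implicit Types (D A : set T) (f g : T -> R[i]) (v w : R[i]).

Definition has_cintegral D f v :=
  [/\ mu.-integrable D (EFin \o (fun x => complex.Re (f x))),
      mu.-integrable D (EFin \o (fun x => complex.Im (f x))) &
      cintegral mu D f = v].

Lemma eq_has_cintegral D f g v :
  (forall x, D x -> f x = g x) -> has_cintegral D f v -> measurable D -> has_cintegral D g v.
Proof.
move=> fg [fR fI fv] mD; split.
- apply: eq_integrable fR => // x /set_mem Dx /=; by rewrite fg.
- apply: eq_integrable fI => // x /set_mem Dx /=; by rewrite fg.
rewrite -fv /cintegral; congr (_ +i* _);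
  by apply: eq_Rintegral => x /set_mem Dx; rewrite fg.
Qed.

Lemma has_cintegralD D f g v w : measurable D ->
  has_cintegral D f v -> has_cintegral D g w ->
  has_cintegral D (fun x => f x + g x) (v + w).
Proof.
move=> mD [fR fI <-] [gR gI <-]; split.
- have := integrableD mD fR gR.
  by apply: eq_integrable => // x _ /=; rewrite ReD.
- have := integrableD mD fI gI.
  by apply: eq_integrable => // x _ /=; rewrite ImD.
apply: complex_eqP; rewrite ?ReD ?ImD /= -RintegralD //.
  by apply: eq_Rintegral => x _; rewrite ReD.
by apply: eq_Rintegral => x _; rewrite ImD.
Qed.

Lemma has_cintegralZ D c f v : measurable D ->
  has_cintegral D f v -> has_cintegral D (fun x => c * f x) (c * v).
Proof.
move=> mD [fR fI <-].
have ZR a := integrableZl mD a fR; have ZI a := integrableZl mD a fI.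
split.
- have := integrableB mD (ZR (complex.Re c)) (ZI (complex.Im c)).
  by apply: eq_integrable => // x _ /=; rewrite ReM.
- have := integrableD mD (ZI (complex.Re c)) (ZR (complex.Im c)).
  by apply: eq_integrable => // x _ /=; rewrite ImM.
apply: complex_eqP; rewrite ?ReM ?ImM /= -!RintegralZl //.
  rewrite -RintegralB //; try exact: ZR; try exact: ZI.
  by apply: eq_Rintegral => x _; rewrite ReM.
rewrite -RintegralD //; try exact: ZR; try exact: ZI.
by apply: eq_Rintegral => x _; rewrite ImM.
Qed.

Lemma has_cintegral_real D (h : T -> R) : measurable D ->
  mu.-integrable D (EFin \o h) ->
  has_cintegral D (fun x => (h x)%:C) (\int[mu]_(x in D) h x)%:C.
Proof.
move=> mD hi; split => //; first exact: integrable0.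
by rewrite /cintegral /= /Rintegral integral0.
Qed.

Lemma has_cintegral0 D : measurable D -> has_cintegral D (fun=> 0) 0.
Proof.
move=> mD; have := has_cintegral_real (h := fun=> 0) mD (integrable0 mu D).
by rewrite /Rintegral integral0; apply.
Qed.

Lemma has_cintegral_indic D A : measurable D -> measurable A -> A `<=` D ->
  (mu A < +oo)%E -> has_cintegral D (fun x => (\1_A x)%:C) (fine (mu A))%:C.
Proof.
move=> mD mA AD muA.
have AI : mu (A `&` D) = mu A by rewrite setIidl.
have iA : mu.-integrable D (EFin \o \1_A).
  apply/integrableP; split; first exact/measurable_realfun.measurable_EFinP.
  rewrite (eq_integral (fun x => (\1_A x)%:E)); last first.
    by move=> t _; rewrite /= ger0_norm.
  by rewrite integral_indic // AI.
have := has_cintegral_real mD iA.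
by rewrite /Rintegral integral_indic // AI.
Qed.

Lemma has_cintegral_sum D (I : Type) (s : seq I) (P : pred I)
    (F : I -> T -> R[i]) (v : I -> R[i]) :
  measurable D -> (forall i, P i -> has_cintegral D (F i) (v i)) ->
  has_cintegral D (fun x => \sum_(i <- s | P i) F i x) (\sum_(i <- s | P i) v i).
Proof.
move=> mD Fv; elim: s => [|i s IH].
  rewrite big_nil; apply: eq_has_cintegral (has_cintegral0 mD) mD => x _.
  by rewrite big_nil.
rewrite big_cons; case: ifPn => Pi; last first.
  by apply: eq_has_cintegral IH mD => x _; rewrite big_cons (negPf Pi).
have := has_cintegralD mD (Fv i Pi) IH => H.
by apply: eq_has_cintegral H mD => x _; rewrite big_cons Pi.
Qed.

Lemma partition_sumE (I : finType) (P : pred I) (A : I -> set T) (c : I -> R[i]) f x :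
  (forall i j x, A i x -> A j x -> i = j) ->
  (forall i, P i -> A i x -> f x = c i) ->
  ((forall i, P i -> ~ A i x) -> f x = 0) ->
  f x = \sum_(i | P i) c i * (\1_(A i) x)%:C.
Proof.
move=> dis fc f0; have [[i [Pi Ai]]|nA] := pselect (exists i, P i /\ A i x).
  rewrite (fc i) // (bigD1 i) //= indicE mem_set // mulr1 big1 ?addr0 //.
  move=> j /andP[_ ji]; rewrite indicE memNset ?mulr0 // => Aj.
  by rewrite (dis _ _ _ Aj Ai) eqxx in ji.
rewrite f0; last by move=> i Pi Ai; apply: nA; exists i.
rewrite big1 // => i Pi; rewrite indicE memNset ?mulr0 // => Ai.
by apply: nA; exists i.
Qed.

(** The sets need not cover [D]: [f] vanishes on what they leave. Equal measures let a single factor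
    [m] come out of the sum, as happens with balls of one radius. *)
Lemma has_cintegral_partition D (I : finType) (P : pred I) (A : I -> set T)
    (c : I -> R[i]) (m : R) f :
  measurable D ->
  (forall i, P i -> measurable (A i)) -> (forall i, P i -> A i `<=` D) ->
  (forall i, P i -> mu (A i) = m%:E) ->
  (forall i j x, A i x -> A j x -> i = j) ->
  (forall i x, P i -> A i x -> f x = c i) ->
  (forall x, D x -> (forall i, P i -> ~ A i x) -> f x = 0) ->
  has_cintegral D f (m%:C * \sum_(i | P i) c i).
Proof.
move=> mD mA AD muA dis fc f0; rewrite mulrC mulr_suml.
have H : has_cintegral D (fun x => \sum_(i | P i) c i * (\1_(A i) x)%:C)
    (\sum_(i | P i) c i * m%:C).
  apply: has_cintegral_sum => // i Pi; apply: has_cintegralZ => //.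
  have := has_cintegral_indic mD (mA i Pi) (AD i Pi); rewrite muA //=.
  by apply; rewrite ltry.
apply: eq_has_cintegral H mD => x Dx; symmetry.
by apply: partition_sumE => // [i Pi|]; [exact: fc|exact: f0].
Qed.

End ComplexIntegral.

(** * Transversals and additive characters *)

Lemma open_measurable_borel (T : ptopologicalType) (U : set T) :
  open U -> measurable (U : set (borel T)).
Proof. by move=> oU; exact: sub_sigma_algebra. Qed.

Section PadicTransversals.
Variables (p : nat) (p_pr : prime p).
Local Notation K := (padic p_pr).
Local Notation B k x := (@padic_ball p p_pr 0 k x).
Implicit Types (x y : K) (k l : int) (r : nat).

(* Representatives of [p^l Z_p] modulo [p^(l + r) Z_p]. *)
Definition grid l r (t : 'I_(p ^ r)) : K := p%:R ^ l * (t : nat)%:R.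

Lemma grid_ball l r (t : 'I_(p ^ r)) : B l (grid l t).
Proof. apply: ballMl; [exact: ball_pow|exact: ball_nat]. Qed.

Lemma grid_inj l r (t t' : 'I_(p ^ r)) :
  B (l + r%:Z) (grid l t - grid l t') -> t = t'.
Proof.
wlog tt : t t' / (t' <= t)%N => [H|].
  have [tt|/ltnW tt] := leqP t' t; first exact: H.
  by move=> /ballBC /(H _ _ tt).
rewrite /grid -mulrBr -natrB // => /ball_scale.
rewrite addrC addrA addNr add0r => /ball_nat_dvd /dvdn_leq H.
apply/val_inj/eqP; rewrite /= eqn_leq tt andbT -subn_eq0 -leqn0 leqNgt.
apply/negP => t0; have := H t0; apply/negP; rewrite -ltnNge.
exact: leq_ltn_trans (leq_subr _ _) (ltn_ord t).
Qed.

Lemma grid_ex l r x : B l x -> exists t : 'I_(p ^ r), B (l + r%:Z) (x - grid l t).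
Proof. by move=> /(ball_residue r)[m [mr xm]]; exists (Ordinal mr). Qed.

Definition ball_periodic k (V : Type) (f : K -> V) :=
  forall x y, B k (y - x) -> f y = f x.

(** A function of period [p^k Z_p] lives on the quotient, and both families represent the same
    classes once each; sending a representative in [d] to the one in [c] is the required
    bijection. *)
Lemma transversal_sum (V : zmodType) (I J : finType) (P : pred I)
    (c : I -> K) (d : J -> K) k (f : K -> V) :
  ball_periodic k f ->
  (forall i i', P i -> P i' -> B k (c i - c i') -> i = i') ->
  (forall j j', B k (d j - d j') -> j = j') ->
  (forall i, P i -> exists j, B k (c i - d j)) ->
  (forall j, exists i, P i /\ B k (c i - d j)) ->
  \sum_(i | P i) f (c i) = \sum_j f (d j).
Proof.
move=> fk ci dj cd dc; have [h hP] := choice dc.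
have hinj : {in [set: J] &, injective h}.
  move=> j j' _ _ hh; apply: dj.
  rewrite -(subrKA (c (h j))); apply: ballD; last by rewrite hh; case: (hP j').
  by apply: ballBC; case: (hP j).
transitivity (\sum_(i in h @: [set: J]%SET) f (c i)).
  apply: eq_bigl => i; apply/idP/imsetP => [Pi|[j _ ->]]; last by case: (hP j).
  have [j ij] := cd i Pi; exists j; rewrite ?inE //.
  have [Phj hj] := hP j; apply: ci => //.
  by rewrite -(subrKA (d j)); apply: ballD => //; apply: ballBC.
rewrite big_imset /=; last by move=> j j' _ _; apply: hinj; rewrite ?inE.
apply: eq_big => [j|j _]; first by rewrite inE.
by apply: fk; case: (hP j).
Qed.

Lemma grid_sum_shift (V : zmodType) l r (f : K -> V) x0 :
  ball_periodic (l + r%:Z) f -> B l x0 ->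
  \sum_(t < p ^ r) f (grid l t + x0) = \sum_(t < p ^ r) f (grid l t).
Proof.
move=> fk x0l; apply: (@transversal_sum _ _ _ predT (fun t => grid l t + x0) (@grid l r)
  _ _ fk).
- by move=> t t' _ _; rewrite opprD addrACA subrr addr0 => /grid_inj.
- by move=> t t' /grid_inj.
- by move=> t _; apply: grid_ex; apply: ballD => //; exact: grid_ball.
move=> t; have [s sP] := grid_ex r (ballB (grid_ball l t) x0l).
exists s; split=> //; apply: ballBC.
by rewrite opprD addrA addrAC.
Qed.

Lemma grid_sum_ball (V : zmodType) l r j r' (f : K -> V) :
  l + r%:Z = j + r'%:Z -> l <= j -> ball_periodic (l + r%:Z) f ->
  \sum_(t < p ^ r | `[< B j (grid l t) >]) f (grid l t) =
  \sum_(t < p ^ r') f (grid j t).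
Proof.
move=> lj llj fk.
apply: (@transversal_sum _ _ _ (fun t => `[< B j (grid l t) >]) (@grid l r)
  (@grid j r') _ _ fk).
- by move=> t t' _ _ /grid_inj.
- by rewrite lj => t t' /grid_inj.
- by rewrite lj => t /asboolP tj; exact: grid_ex.
move=> t; have [s sP] := grid_ex r (ball_le llj (grid_ball j t)).
exists s; split; last exact: ballBC.
apply/asboolP; rewrite -(subrK (grid j t) (grid l s)).
apply: ballD; last exact: grid_ball.
by apply: ball_le (ballBC sP); lia.
Qed.

(** * The additive character of Q_p *)

Section Character.
Variable R : realType.
Local Notation frac := (@fracpart R p p_pr).

Definition chi x : R[i] := cexp ('i * (2 * pi * frac x)%:C).

(* The rational number [a / p^e], read both in [Q_p] and in [R]. *)
Definition same_fraction x (t : R) :=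
  exists (a : int) (e : nat), x = a%:~R / p%:R ^+ e /\ t = a%:~R / p%:R ^+ e.

Let pR_neq0 : p%:R != 0 :> R.
Proof. by rewrite pnatr_eq0 -lt0n prime_gt0. Qed.

Lemma same_fractionN x t : same_fraction x t -> same_fraction (- x) (- t).
Proof. by move=> [a [e [-> ->]]]; exists (- a), e; rewrite !mulrNz !mulNr. Qed.

Lemma same_fractionD x y t u :
  same_fraction x t -> same_fraction y u -> same_fraction (x + y) (t + u).
Proof.
have aux (F : fieldType) (a b : int) e e' : (p%:R != 0 :> F) ->
  a%:~R / p%:R ^+ e + b%:~R / p%:R ^+ e' =
  (a * (p ^ e')%N%:Z + b * (p ^ e)%N%:Z)%:~R / p%:R ^+ (e + e') :> F.
  move=> p0; rewrite addf_div ?expf_neq0 // -exprD intrD !intrM -!pmulrn.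
  by rewrite !natrX.
move=> [a [e [-> ->]]] [b [e' [-> ->]]].
exists (a * (p ^ e')%N%:Z + b * (p ^ e)%N%:Z), (e + e')%N.
by split; apply: aux => //; exact: padic_p_neq0.
Qed.

(** A fraction whose denominator is a power of [p] and which lies in [Z_p] is an integer. This turns
    p-adic congruences modulo [Z_p] into real congruences modulo the integers, hence the additivity
    of [chi]. *)
Lemma same_fraction_int x t :
  same_fraction x t -> B 0 x -> exists z : int, t = z%:~R.
Proof.
move=> [a [e [-> ->]]] aB.
have : B e (a%:~R : K).
  have := ballMr aB (ball_pow p_pr e); rewrite -exprnP mulfVK //.
  by rewrite expf_neq0 // padic_p_neq0.
have aux (m : nat) : B e (m%:R : K) -> exists z : int, m%:R / p%:R ^+ e = z%:~R :> R.
  move=> /ball_nat_dvd/dvdnP[q ->]; exists q.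
  by rewrite natrM natrX mulfK ?expf_neq0 // pmulrn.
case: a {aB} => m /=; first by rewrite -!pmulrn; exact: aux.
rewrite NegzE !mulrNz -!pmulrn => /ballN; rewrite opprK => /aux[z zE].
by exists (- z); rewrite mulNr zE mulrNz.
Qed.

Lemma fracpartP x : [/\ exists2 y, same_fraction y (frac x) & B 0 (x - y),
  0 <= frac x & frac x < 1].
Proof.
rewrite /fracpart; case: xgetP => [t _ [m [k [mk -> xB]]]|/= H].
  split.
  - exists (m%:R / p%:R ^+ k); last by move: xB; rewrite unit_ballE.
    by exists m%:Z, k; rewrite -!pmulrn.
  - by rewrite divr_ge0 ?exprn_ge0 ?ler0n.
  - rewrite ltr_pdivrMr ?exprn_gt0 ?ltr0n ?prime_gt0 //.
    by rewrite mul1r -natrX ltr_nat.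
(* The default value of [xget] is never taken: [x] lies in some [p^(-k) Z_p], and its residue modulo
   [Z_p] provides [m]. *)
exfalso; have [j xj] := ball_ex x.
pose k := `|j|%N; have xk : B (- k%:Z) x by apply: ball_le xj; rewrite /k; lia.
have [m [mk xm]] := ball_residue k xk.
apply: (H (m%:R / p%:R ^+ k)); exists m, k; split=> //.
by rewrite unit_ballE /=; move: xm; rewrite addNr mulrC exprnN.
Qed.

Lemma chi_int x (z : int) : frac x = z%:~R -> chi x = 1.
Proof. by rewrite /chi => ->; rewrite cexp_2pi_int. Qed.

Lemma chi_ball x : B 0 x -> chi x = 1.
Proof.
move=> x0; have [[y yx xy] _ _] := fracpartP x.
have [z zE] : exists z : int, frac x = z%:~R.
  apply: same_fraction_int yx _; rewrite -(subKr x y); exact: ballB.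
exact: chi_int zE.
Qed.

Lemma chiD x y : chi (x + y) = chi x * chi y.
Proof.
have [[x' sx xx'] _ _] := fracpartP x; have [[y' sy yy'] _ _] := fracpartP y.
have [[w sw ww] _ _] := fracpartP (x + y).
have [z zE] : exists z : int, frac (x + y) - (frac x + frac y) = z%:~R.
  apply: (same_fraction_int (same_fractionD sw (same_fractionN (same_fractionD sx sy)))).
  have -> : w - (x' + y') = (x - x') + (y - y') - (x + y - w).
    by rewrite [in RHS]addrACA -opprD opprB [RHS]addrC [RHS]addrA subrK.
  by apply: ballB => //; apply: ballD.
have wD (t u : R) :
    'i * (2 * pi * (t + u))%:C = 'i * (2 * pi * t)%:C + 'i * (2 * pi * u)%:C.
  by rewrite -mulrDr -rmorphD -mulrDr.
rewrite /chi -cexpD -wD -[frac (x + y)](subrK (frac x + frac y)) zE.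
by rewrite (wD z%:~R) cexpD cexp_2pi_int mul1r.
Qed.

(** Otherwise the fractional part of [1/p] would be an integer in [[0, 1[], hence zero, and [1/p]
    would belong to [Z_p]. *)
Lemma chi_pV : chi (p%:R ^ (-1)) != 1.
Proof.
apply/eqP => /cexp_eq1[k] /(congr1 (@complex.Im R)) /=.
rewrite !mul0r !add0r !mul1r => /(mulfI _) fk.
have [[y sy yy] f0 f1] := fracpartP (p%:R ^ (-1)).
have {}fk : frac (p%:R ^ -1) = k%:~R.
  by apply: fk; rewrite mulf_neq0 // ?pnatr_eq0 // gt_eqF // pi_gt0.
have k0 : k = 0 by move: f0 f1; rewrite fk ler0z ltrz1; lia.
move: sy => [a [e [yE]]]; rewrite fk k0 => /esym/eqP.
rewrite mulf_eq0 invr_eq0 expf_eq0 (negPf pR_neq0) andbF orbF intr_eq0 => /eqP a0.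
by move: yy; rewrite yE a0 mul0r subr0 ball_p; lia.
Qed.

Lemma chi_periodic (a : K) k : B (- k) a -> ball_periodic k (fun x => chi (a * x)).
Proof.
move=> ak x y xy; rewrite -(subrK x y) mulrDr chiD chi_ball ?mul1r //.
by have := ballM ak xy; rewrite addNr.
Qed.

(* A nontrivial character of a finite group, here [p^l Z_p / p^(l + r) Z_p],
   has zero sum. *)
Lemma grid_sum_chi (a : K) l r : B (- (l + r%:Z)) a ->
  \sum_(t < p ^ r) chi (a * grid l t) =
  (if `[< B (- l) a >] then (p ^ r)%N%:R else 0).
Proof.
move=> ak; case: ifPn => [/asboolP al|/asboolPn al].
  rewrite (eq_bigr (fun=> 1)); last first.
    by move=> t _; rewrite chi_ball //; have := ballM al (grid_ball l t); rewrite addNr.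
  by rewrite sumr_const card_ord.
have a0 := ballN_neq0 al.
have vl : pval a < - l by rewrite ltNge; apply/negP => /(pvalP _ a0).
(* Chosen so that [a * x0 = 1/p], where [chi] is not 1; [x0] lies in [p^l Z_p] exactly because [a]
   is not in [p^(-l) Z_p]. Translation by [x0] preserves the sum and multiplies it by
   [chi (1/p)]. *)
set x0 := a^-1 * p%:R ^ (-1).
have x0l : B l x0.
  apply: ball_le (ballM (pvalV a0) (ball_pow p_pr (-1))); lia.
have := grid_sum_shift (chi_periodic ak) x0l.
rewrite (eq_bigr (fun t : 'I_(p ^ r) => chi (a * grid l t) * chi (p%:R ^ (-1)))); last first.
  by move=> t _; rewrite mulrDr chiD /x0 (mulrA a a^-1) (mulfV a0) mul1r.
rewrite -mulr_suml => /eqP; rewrite -subr_eq0 -{2}[\sum_(_ < _) _]mulr1 -mulrBr.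
by rewrite mulf_eq0 subr_eq0 (negPf chi_pV) orbF => /eqP.
Qed.

End Character.
End PadicTransversals.

(** * Boxes and Haar measure *)

Section PadicBoxes.
Variables (p : nat) (p_pr : prime p).
Local Notation K := (padic p_pr).
Local Notation B k x := (@padic_ball p p_pr 0 k x).

Lemma open_padic_ball (x : K) (k : int) : open (padic_ball x k).
Proof.
move=> y /padic_ballE xy; exists `|k|%N => z /padic_ballE yz; apply/padic_ballE.
rewrite -(subrKA y); apply: ballD => //; apply: ball_le yz; lia.
Qed.

Lemma measurable_padic_ball (x : K) (k : int) :
  measurable (padic_ball x k : set (borel K)).
Proof. by apply: open_measurable_borel; exact: open_padic_ball. Qed.

Definition vball n (x : 'rV[K]_n) (k : int) : set 'rV[K]_n :=
  [set y | forall i, padic_ball (x 0 i) k (y 0 i)].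

Lemma vballI n (x y : 'rV[K]_n) k :
  (forall i, B k (y 0 i - x 0 i)) -> vball x k y.
Proof. by move=> H i; move: (H i); rewrite -(padic_ballE (x 0 i)). Qed.

Lemma vballE n (x y : 'rV[K]_n) k i : vball x k y -> B k (y 0 i - x 0 i).
Proof. by move/(_ i); rewrite (padic_ballE (x 0 i)). Qed.

Lemma vball_sym n (x y : 'rV[K]_n) k : vball x k y -> vball y k x.
Proof. by move=> xy; apply: vballI => i; apply: ballBC; exact: vballE. Qed.

Lemma vball_trans n (y x z : 'rV[K]_n) k : vball x k y -> vball y k z -> vball x k z.
Proof.
move=> xy yz; apply: vballI => i.
by rewrite -(subrKA (y 0 i)); apply: ballD; exact: vballE.
Qed.

Lemma vball_le n (x : 'rV[K]_n) j k : j <= k -> vball x k `<=` vball x j.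
Proof. by move=> jk y xy; apply: vballI => i; apply: ball_le jk _; exact: vballE. Qed.

Lemma nbhs_vball n (x : 'rV[K]_n) (A : set 'rV[K]_n) :
  nbhs x A <-> exists k : nat, vball x k `<=` A.
Proof.
split=> [[P xP PA]|[k kA]].
  have /choice[k kP] i : exists k : nat, padic_ball (x 0 i) k `<=` P 0 i.
    have /nbhs_interior := xP 0 i; rewrite nbhsE => -[U [oU Ux] UP].
    by have [k kU] := oU _ Ux; exists k => y /kU /UP /interior_subset.
  exists (\max_i k i)%N => y xy; apply: PA => i j; rewrite ord1.
  apply: kP; apply/padic_ballE; apply: ball_le (_ : B (\max_i k i)%N _).
    by rewrite lez_nat; apply: leq_bigmax.
  exact: vballE.
exists (fun _ j => padic_ball (x 0 j) k) => [i j|y xy].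
  rewrite (ord1 i); apply: open_nbhs_nbhs; split; first exact: open_padic_ball.
  by apply/padic_ballE; rewrite subrr; exact: ball0.
by apply: kA => i; exact: xy.
Qed.

Lemma open_vball n (x : 'rV[K]_n) (k : int) : open (vball x k).
Proof.
rewrite openE => y xy; apply/nbhs_vball; exists `|k|%N => z yz.
by apply: vball_trans xy _; apply: vball_le yz; lia.
Qed.

Lemma measurable_vball n (x : 'rV[K]_n) (k : int) :
  measurable (vball x k : set (borel 'rV[K]_n)).
Proof. by apply: open_measurable_borel; exact: open_vball. Qed.

Definition vball_periodic n k (V : Type) (f : 'rV[K]_n -> V) :=
  forall x y, vball x k y -> f y = f x.

(** Compactness of the support makes the radius of local constancy uniform; the near-covering form
    gives one [N] directly, which also bounds the support. *)
Lemma test_function_uniform n (V : zmodType) (psi : 'rV[K]_n -> V) :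
  test_function psi -> exists N : nat, vball_periodic N psi /\
    forall x, psi x != 0 -> vball 0 (- N%:Z) x.
Proof.
move=> [psil /compact_near_coveringP psic].
pose P (N : nat) (x : 'rV[K]_n) := (forall y, vball x N y -> psi y = psi x) /\
  vball 0 (- N%:Z) x.
have [N _ NP] : \forall N \near \oo, closure [set x | psi x != 0] `<=` P N.
  apply: psic => x _.
  have /nbhs_vball[k kx] : nbhs x [set y | psi y = psi x] := psil x.
  have /choice[l lP] i := ball_ex (x 0 i).
  pose M := (k + \max_i `|l i|)%N.
  exists (vball x k, [set N | (M <= N)%N]) => /=.
    split; first by apply/nbhs_vball; exists k.
    by exists M.
  move=> [y N] [/= xy MN]; split=> [z yz|].
    have kN : k%:Z <= N by rewrite lez_nat; apply: leq_trans MN; exact: leq_addr.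
    by rewrite (kx z) ?(kx y) //; apply: vball_trans xy _; exact: vball_le yz.
  apply: vballI => i; rewrite mxE subr0 -(subrK (x 0 i) (y 0 i)).
  have li : `|l i|%:Z <= N.
    rewrite lez_nat; apply: leq_trans MN; apply: leq_trans (leq_addl _ _).
    exact: (leq_bigmax (F := fun i => `|l i|%N)).
  apply: ballD; last by apply: ball_le (lP i); lia.
  by apply: ball_le (vballE i xy); lia.
have {}NP x : psi x != 0 -> P N x.
  by move=> x0; apply: (NP N) => //=; exact: subset_closure.
exists N; split=> [x y xy|x /NP[] //].
(* Uniformity is known only on the support. If either value is nonzero, the ball around that point
   contains the other one; if both vanish, they agree. *)
have [x0|/NP[H _]] := eqVneq (psi x) 0; last exact: H.
have [y0|/NP[H _]] := eqVneq (psi y) 0; first by rewrite x0 y0.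
by rewrite (H x) //; exact: vball_sym.
Qed.

End PadicBoxes.

Section HaarMeasure.
Variables (R : realType) (p : nat) (p_pr : prime p).
Local Notation K := (padic p_pr).
Local Notation B k x := (@padic_ball p p_pr 0 k x).
Variable mu : {measure set (borel K) -> \bar R}.
Hypothesis haar_mu : is_haar mu.

Let pR_neq0 : p%:R != 0 :> R.
Proof. by rewrite pnatr_eq0 -lt0n prime_gt0. Qed.

Lemma haar_padic_ball_shift (x : K) k : mu (padic_ball x k) = mu (padic_ball 0 k).
Proof.
rewrite -(haar_mu.1 x (padic_ball 0 k)); last exact: measurable_padic_ball.
congr (mu _); apply/seteqP; split=> y /=.
  by move=> /padic_ballE yx; exists (y - x) => //; rewrite addrC subrK.
by move=> [z zk <-]; apply/padic_ballE; rewrite addrC addKr.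
Qed.

Lemma haar_ball_split l r :
  mu (padic_ball 0 l) = ((p ^ r)%:R%:E * mu (padic_ball 0%R (l + r%:Z)%R))%E.
Proof.
have -> : padic_ball 0 l =
    \big[setU/set0]_(t < p ^ r) padic_ball (grid p_pr l t) (l + r%:Z).
  rewrite -bigcup_seq; apply/seteqP; split=> x.
    move=> xl; have [t tP] := grid_ex r xl; exists t; first exact: mem_index_enum.
    exact/padic_ballE.
  move=> [t _ /padic_ballE xt]; rewrite -(subrK (grid p_pr l t) x).
  by apply: ballD; [apply: ball_le xt; lia|exact: grid_ball].
rewrite measure_semi_additive_ord //=.
- rewrite (eq_bigr (fun=> mu (padic_ball 0 (l + r%:Z)))); last first.
    by move=> t _; exact: haar_padic_ball_shift.
  by rewrite big_const_ord iter_addr addr0 mule_natl.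
- by move=> t; exact: measurable_padic_ball.
- apply/trivIsetP => t t' _ _ tt'; apply/seteqP; split=> // x.
  move=> [/padic_ballE xt /padic_ballE xt'].
  case/eqP: tt'; apply: (@grid_inj _ p_pr l).
  by rewrite -(subrKA x); apply: ballD => //; exact: ballBC.
- by apply: bigsetU_measurable => t _; exact: measurable_padic_ball.
Qed.

(** Only the unit ball has a prescribed measure: small balls are found by splitting it, large ones
    by splitting them into translates of it. *)
Lemma haar_padic_ball (x : K) k : mu (padic_ball x k) = (p%:R ^ (- k))%:E.
Proof.
rewrite haar_padic_ball_shift.
have mu0 : mu (padic_ball 0 0) = 1%E.
  by rewrite -(haar_mu.2) unit_ballE; congr (mu _).
case: k => k.
  have := haar_ball_split 0 k; rewrite mu0 add0r => muk.
  have pk0 : (p ^ k)%N%:R != 0 :> R by rewrite natrX expf_neq0.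
  (* An infinite measure here would make that of the unit ball infinite; finiteness allows the
     cancellation in the reals. *)
  have muf : mu (padic_ball 0 k) \is a fin_num.
    rewrite ge0_fin_numE // ltey; apply/eqP => muy; move: muk; rewrite muy.
    by rewrite gt0_muley // lte_fin lt_neqAle eq_sym pk0 ler0n.
  move: muk; rewrite -(fineK muf) -EFinM => -[muk]; congr EFin.
  apply: (mulfI pk0); rewrite -muk natrX -exprnN mulfV //.
  by rewrite expf_neq0.
have := haar_ball_split (Negz k) k.+1.
rewrite NegzE addNr mu0 mule1 => ->; rewrite opprK natrX.
by [].
Qed.

End HaarMeasure.

(** * Fourier transform of locally constant functions *)

Lemma real_complexXz (R : realType) (x : R) (k : int) : (x ^ k)%:C = x%:C ^ k.
Proof. by case: k => k; rewrite /exprz ?fmorphV rmorphXn. Qed.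

Section FourierSums.
Variables (R : realType) (p : nat) (p_pr : prime p).
Local Notation K := (padic p_pr).
Local Notation B k x := (@padic_ball p p_pr 0 k x).
Variables (mu : {measure set (borel K) -> \bar R}) (haar_mu : is_haar mu).
Variables (n : nat) (mun : {measure set (borel 'rV[K]_n) -> \bar R}).
Hypothesis mun_power : is_power_measure mu mun.
Implicit Types (k l : int) (r : nat).

Definition vgrid l r (t : {ffun 'I_n -> 'I_(p ^ r)}) : 'rV[K]_n :=
  \row_i grid p_pr l (t i).

(** Up to the factor [p^(-k)], the Fourier transform of the indicator of [c + p^k Z_p]. *)
Definition char_ball k (c x : K) : R[i] :=
  if `[< B (- k) x >] then chi R (x * c) else 0.

Lemma power_measure_vball (x : 'rV[K]_n) k :
  mun (vball x k) = ((p%:R ^ (- k)) ^+ n)%:E.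
Proof.
rewrite (mun_power (A := fun i => padic_ball (x 0 i) k)); last first.
  by move=> i; exact: measurable_padic_ball.
rewrite (eq_bigr (fun=> (p%:R ^ (- k))%:E)); last first.
  by move=> i _; exact: haar_padic_ball.
by rewrite prodEFin prodr_const card_ord.
Qed.

Lemma padic_char_prod (xi x : 'rV[K]_n) :
  padic_char R xi x = \prod_i chi R (xi 0 i * x 0 i).
Proof.
rewrite /padic_char mulr_sumr rmorph_sum mulr_sumr cexp_sum.
by apply: eq_bigr => i _; rewrite /chi.
Qed.

Lemma fourier_grid (psi : 'rV[K]_n -> R[i]) l r (xi : 'rV[K]_n) :
  vball_periodic (l + r%:Z) psi -> (forall x, psi x != 0 -> vball 0 l x) ->
  fourier mun psi xi = (p%:R ^ (- (l + r%:Z))) ^+ n *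
    \sum_(t : {ffun 'I_n -> 'I_(p ^ r)}) psi (vgrid l t) *
      \prod_i char_ball (l + r%:Z) (grid p_pr l (t i)) (xi 0 i).
Proof.
move=> psip psil; set k := l + r%:Z.
(* Boxes of level [k] suit [psi] but not the character. The refinement [s], which depends on [xi],
   makes each [chi (xi_i x_i)] constant on the smaller boxes. *)
have [s sP] : exists s : nat, forall i, B (- (k + s%:Z)) (xi 0 i).
  have /choice[e eP] i := ball_ex (xi 0 i).
  exists (\max_i `|- k - e i|)%N => i; apply: ball_le (eP i).
  have := leq_bigmax (F := fun i => `|- k - e i|%N) i; lia.
pose I := ({ffun 'I_n -> 'I_(p ^ r)} * {ffun 'I_n -> 'I_(p ^ s)})%type.
pose c (u : I) := vgrid l u.1 + vgrid k u.2.
have cE u i : c u 0 i = grid p_pr l (u.1 i) + grid p_pr k (u.2 i).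
  by rewrite !mxE.
have psic u x : vball (c u) (k + s%:Z) x -> psi x = psi (vgrid l u.1).
  move=> cx; apply: psip; apply: vballI => i; rewrite mxE.
  rewrite -(subrKA (c u 0 i)); apply: ballD.
    by apply: ball_le (vballE i cx); rewrite /k; lia.
  by rewrite cE addrAC subrr add0r; exact: grid_ball.
have H : has_cintegral mun setT (fun x => padic_char R xi x * psi x)
   (((p%:R ^ (- (k + s%:Z))) ^+ n)%:C *
      \sum_(u : I) padic_char R xi (c u) * psi (vgrid l u.1)).
  apply: (@has_cintegral_partition _ _ _ mun setT I predT
    (fun u => vball (c u) (k + s%:Z))
    (fun u => padic_char R xi (c u) * psi (vgrid l u.1))) => //.
  - by move=> u _; exact: measurable_vball.
  - by move=> u _; exact: power_measure_vball.
  - move=> u v x ux vx.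
    have uv i : B (k + s%:Z) (c u 0 i - c v 0 i).
      by rewrite -(subrKA (x 0 i)); apply: ballD; [apply: ballBC|]; exact: vballE.
    have uv1 : u.1 = v.1.
      apply/ffunP => i; apply: (@grid_inj _ p_pr l).
      have := uv i; rewrite !cE opprD addrACA => H.
      rewrite -[_ - _](addrK (grid p_pr k (u.2 i) - grid p_pr k (v.2 i))).
      apply: ballB; first by apply: ball_le H; rewrite /k; lia.
      by apply: ballB; exact: grid_ball.
    have uv2 : u.2 = v.2.
      apply/ffunP => i; apply: (@grid_inj _ p_pr k).
      by have := uv i; rewrite !cE uv1 opprD addrACA subrr add0r.
    by move: u v uv1 uv2 {uv ux vx} => [u1 u2] [v1 v2] /= -> ->.
  - move=> u x _ ux; rewrite (psic _ _ ux) !padic_char_prod; congr (_ * _).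
    apply: eq_bigr => i _; apply: (chi_periodic R (sP i)); exact: vballE.
  - move=> x _ nx; have [->|x0] := eqVneq (psi x) 0; first by rewrite mulr0.
    exfalso; have /psil xl := x0.
    have /choice[t tP] i : exists t : 'I_(p ^ r), B k (x 0 i - grid p_pr l t).
      by apply: grid_ex; have := vballE i xl; rewrite mxE subr0.
    have /choice[w wP] i := grid_ex s (tP i).
    apply: (nx ([ffun i => t i], [ffun i => w i])) => //.
    by apply: vballI => i; rewrite cE !ffunE opprD addrA.
case: H => _ _; rewrite -/(fourier mun psi xi) => ->.
rewrite -(pair_bigA _ (fun t w => padic_char R xi (c (t, w)) * psi (vgrid l t))) /=.
rewrite rmorphXn /= real_complexXz rmorph_nat !mulr_sumr; apply: eq_bigr => t _.
rewrite -mulr_suml mulrA [RHS]mulrCA [RHS]mulrC; congr (_ * _).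
transitivity ((p%:R ^ (- (k + s%:Z))) ^+ n *
  \sum_(w : {ffun 'I_n -> 'I_(p ^ s)})
    \prod_i (chi R (xi 0 i * grid p_pr l (t i)) * chi R (xi 0 i * grid p_pr k (w i)))).
  congr (_ * _); apply: eq_bigr => w _; rewrite padic_char_prod.
  by apply: eq_bigr => i _; rewrite cE mulrDr chiD.
(* The sum over the fine offsets factors into one-dimensional character sums, and [grid_sum_chi]
   turns each of them into the cutoff [|xi_i| <= p^k] of [char_ball]. *)
rewrite -(bigA_distr_bigA (fun i (v : 'I_(p ^ s)) =>
  chi R (xi 0 i * grid p_pr l (t i)) * chi R (xi 0 i * grid p_pr k v))) /=.
have pown (x : R[i]) : x ^+ n = \prod_(i < n) x.
  by rewrite prodr_const card_ord.
rewrite !pown -!big_split /=.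
apply: eq_bigr => i _; rewrite -mulr_sumr grid_sum_chi // /char_ball.
case: ifP => _; last by rewrite !mulr0.
rewrite mulrCA mulrC; congr (_ * _).
have p0 : p%:R != 0 :> R[i] by rewrite pnatr_eq0 -lt0n prime_gt0.
by rewrite natrX exprnP -expfzDr //; congr (_ ^ _); lia.
Qed.

End FourierSums.

(** * Radial kernels *)

Section KernelWeights.
Variables (R : realType) (p : nat) (p_pr : prime p).
Local Notation K := (padic p_pr).
Local Notation B k x := (@padic_ball p p_pr 0 k x).
Local Notation C := R[i].
Local Notation pC := (p%:R : C).
Local Notation g := (@char_ball R p p_pr).
Implicit Types (k l j : int) (r : nat) (x c : K) (s : C) (w T : int -> C).

Lemma pC_neq0 : pC != 0.
Proof. by rewrite pnatr_eq0 -lt0n prime_gt0. Qed.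

Lemma cpow_padic_norm x s : x != 0 ->
  cpow (@padic_norm p p_pr R x) s = cpow p%:R s ^ (- pval x).
Proof.
move=> x0; rewrite /cpow ln_padic_norm // -cexpMz; congr cexp.
by rewrite -mulrNz rmorphM rmorph_int mulrCA mulrzl.
Qed.

(* [w j] is the value of the kernel on the sphere of radius [p^(- j)], and [T j]
   its regularized total mass on [p^j Z_p]. *)
Definition kernel_mass w T :=
  forall j, T j - T (j + 1) = (1 - pC^-1) * pC ^ (- j) * w j.

(** A Riemann sum without its mesh [p^(-(l + r))]. The class of zero is left out because the kernel
    may be singular there; the mass [T] accounts for it. *)
Definition kernel_sum w l r (f : K -> C) :=
  \sum_(t < p ^ r | ~~ `[< B (l + r%:Z) (grid p_pr l t) >])
    w (pval (grid p_pr l t)) * f (grid p_pr l t).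

Definition kernel_sum_in w l r (f : K -> C) j :=
  \sum_(t < p ^ r | ~~ `[< B (l + r%:Z) (grid p_pr l t) >] &&
      `[< B j (grid p_pr l t) >]) w (pval (grid p_pr l t)) * f (grid p_pr l t).

Definition ball_sum l r (f : K -> C) j :=
  \sum_(t < p ^ r | `[< B j (grid p_pr l t) >]) f (grid p_pr l t).

Lemma kernel_sum_in0 w l r f : kernel_sum_in w l r f (l + r%:Z) = 0.
Proof. by rewrite /kernel_sum_in big_pred0 // => t; rewrite andNb. Qed.

Lemma kernel_sum_inT w l r f : kernel_sum_in w l r f l = kernel_sum w l r f.
Proof.
apply: eq_bigl => t; rewrite [X in _ && X](_ : _ = true) ?andbT //.
by apply/asboolP; exact: grid_ball.
Qed.

(** This peels off the points of valuation exactly [j], a sphere on which the weight is constant. *)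
Lemma kernel_sum_inS w l r f j : j + 1 <= l + r%:Z ->
  kernel_sum_in w l r f j = kernel_sum_in w l r f (j + 1) +
    w j * (ball_sum l r f j - ball_sum l r f (j + 1)).
Proof.
move=> jk; rewrite /kernel_sum_in /ball_sum.
have Ble (t : 'I_(p ^ r)) i i' : i <= i' ->
    `[< B i' (grid p_pr l t) >] -> `[< B i (grid p_pr l t) >].
  by move=> ii' /asboolP H; apply/asboolP; exact: ball_le H.
rewrite (bigID (fun t => `[< B (j + 1) (grid p_pr l t) >])) /=; congr (_ + _).
  apply: eq_bigl => t; rewrite -andbA; congr (_ && _).
  by rewrite andb_idl // => /Ble; apply; lia.
rewrite [in RHS](bigID (fun t => `[< B (j + 1) (grid p_pr l t) >])) /=.
have -> : \sum_(t < p ^ r | `[< B j (grid p_pr l t) >] &&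
      `[< B (j + 1) (grid p_pr l t) >]) f (grid p_pr l t) =
    \sum_(t < p ^ r | `[< B (j + 1) (grid p_pr l t) >]) f (grid p_pr l t).
  by apply: eq_bigl => t; rewrite andb_idl // => /Ble; apply; lia.
rewrite addrAC subrr add0r mulr_sumr; apply: eq_big => [t|t].
  rewrite -andbA andb_idl // => /andP[_ /negP nB]; apply/negP => /(Ble t).
  by move=> /(_ _ jk).
move=> /andP[/andP[_ /asboolP tj] /asboolPn tj1]; congr (w _ * _).
exact: pval_unique (ballN_neq0 tj1) tj tj1.
Qed.

Section MassTelescope.
Variables (w T : int -> C).
Hypothesis wT : kernel_mass w T.

(** If [f] behaves like the constant [a] on balls, the sphere of valuation [j] contributes [a w(j)]
    times its measure [(1 - 1/p) p^(-j)], that is [a (T j - T (j + 1))], and the sum telescopes. *)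
Lemma kernel_sum_in_mass l r f a j0 :
  (forall j, j0 <= j <= l + r%:Z ->
    ball_sum l r f j = a * pC ^ (l + r%:Z - j)) ->
  forall j, j0 <= j <= l + r%:Z ->
  pC ^ (- (l + r%:Z)) * kernel_sum_in w l r f j = a * (T j - T (l + r%:Z)).
Proof.
set k := l + r%:Z => E j /andP[j0j jk].
have [d jE] : exists d : nat, j = k - d%:Z by exists `|k - j|%N; lia.
elim: d => [|d IH] in j jE j0j jk *.
  have -> : j = k by lia.
  by rewrite kernel_sum_in0 subrr !mulr0.
rewrite kernel_sum_inS; last by rewrite -/k; lia.
rewrite mulrDr IH; [|lia..].
rewrite !E; [|lia..].
have -> : k - (j + 1) = (k - j) + (- 1) by lia.
rewrite (expfzDr _ (-1) pC_neq0) -mulrBr.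
have aux (u v x y z : C) : u * v = 1 ->
    u * (x * (y * (v * z - v * z * pC^-1))) = x * y * z * (1 - pC^-1).
  by move=> uv; transitivity (u * v * (x * y * z * (1 - pC^-1)));
    [ring|rewrite uv mul1r].
rewrite (expfzDr k (- j) pC_neq0) (_ : pC ^ (-1) = pC^-1) // aux; last first.
  by rewrite -expfzDr ?pC_neq0 // addNr.
have /eqP := wT j; rewrite subr_eq => /eqP ->; ring.
Qed.

End MassTelescope.

Lemma char_ballE k c x : B (- k) x -> g k c x = chi R (x * c).
Proof. by move=> xk; rewrite /char_ball; case: ifPn => // /asboolPn. Qed.

Lemma char_ball_out k c x : ~ B (- k) x -> g k c x = 0.
Proof. by move=> xk; rewrite /char_ball; case: ifPn => // /asboolP. Qed.

Lemma char_ball_periodic k c x i : - k <= i -> B (- i) c ->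
  ball_periodic i (fun y => g k c (x - y)).
Proof.
move=> ki ci y z yz; have zy : B (- k) (y - z) by apply: ball_le (ballBC yz).
have e : x - z = (y - z) + (x - y) by rewrite [RHS]addrC subrKA.
have [xy|xy] := pselect (B (- k) (x - y)).
  rewrite !char_ballE //; last by rewrite e; exact: ballD.
  rewrite e mulrDl chiD chi_ball ?mul1r //.
  by have := ballM (ballBC yz) ci; rewrite addrN.
rewrite !char_ball_out // e => /(ballDr _ zy); exact.
Qed.

(** If [p^j Z_p] lies in [p^(-k) Z_p], the cutoff is the same at [x] and [x - y], so the value at
    [x] factors out of a character sum. A larger ball contains or misses the whole support
    [x + p^(-k) Z_p], over which the character sums to zero since [c] is not in [p^k Z_p]. *)
Lemma char_ball_sum k c x l r j : ~ B k c ->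
  l <= j <= l + r%:Z -> - pval c <= l + r%:Z ->
  ball_sum l r (fun y => g k c (x - y)) j =
  g k c x * (if - pval c <= j then pC ^ (l + r%:Z - j) else 0).
Proof.
move=> kc; set m := pval c => /andP[lj jk] mk.
have c0 := ballN_neq0 kc.
have mk' : m < k by rewrite ltNge; apply/negP => /(pvalP k c0).
have [r' lr] : exists r' : nat, l + r%:Z = j + r'%:Z by exists (absz (l + r%:Z - j)%R); lia.
have cm : B (- (l + r%:Z)) (- c) by apply: ballN; apply/(pvalP _ c0); rewrite -/m; lia.
have per : ball_periodic (l + r%:Z) (fun y => g k c (x - y)).
  by apply: char_ball_periodic; [lia|rewrite -[c]opprK; exact: ballN].
rewrite /ball_sum (grid_sum_ball lr lj per).
have [jk'|jk'] := leP (- k) j.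
  rewrite (eq_bigr (fun t => g k c x * chi R (- c * grid p_pr j t))); last first.
    move=> t _; have tk : B (- k) (- grid p_pr j t).
      by apply: ballN; apply: ball_le (grid_ball _ _ _).
    have [xk|xk] := pselect (B (- k) x).
      rewrite !char_ballE //; last exact: ballD.
      by rewrite mulrDl chiD !mulNr [c * grid _ _ _]mulrC.
    by rewrite !char_ball_out ?mul0r // addrC => /(ballDr _ tk).
  rewrite -mulr_sumr grid_sum_chi -?lr //; congr (_ * _).
  case: ifPn => [/asboolP/ballN|/asboolPn nB]; rewrite ?opprK.
    move/(pvalP _ c0); rewrite -/m => jm; rewrite ifT; last by lia.
    by rewrite natrX exprnP; congr (_ ^ _); lia.
  rewrite ifF //; apply/negbTE/negP => mj; apply: nB; apply: ballN.
  by apply/(pvalP _ c0); rewrite -/m; lia.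
rewrite ifF ?mulr0; last by lia.
have [xj|xj] := pselect (B j x); last first.
  rewrite big1 // => t _; apply: char_ball_out => H; apply: xj.
  rewrite -(subrK (grid p_pr j t) x); apply: ballD; last exact: grid_ball.
  by apply: ball_le H; lia.
have perj : ball_periodic (j + r'%:Z) (fun y => g k c (x - y)) by rewrite -lr.
(* Translating by [x] centers the support at the origin. *)
rewrite -(grid_sum_shift perj xj).
have [r2 lr2] : exists r2 : nat, j + r'%:Z = - k + r2%:Z.
  by exists (absz (l + r%:Z + k)%R); lia.
have perc : ball_periodic (j + r'%:Z) (fun y => chi R (- c * y)).
  by apply: chi_periodic; rewrite -lr.
transitivity (\sum_(t < p ^ r' | `[< B (- k) (grid p_pr j t) >]) chi R (- c * grid p_pr j t)).
  rewrite [RHS]big_mkcond; apply: eq_bigr => t _; rewrite opprD addrCA subrr addr0.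
  case: ifPn => [/asboolP tk|/asboolPn tk].
    rewrite char_ballE; last exact: ballN.
    by rewrite !mulNr [c * grid _ _ _]mulrC.
  by rewrite char_ball_out // => /ballN; rewrite opprK.
rewrite (grid_sum_ball lr2 _ perc); last by lia.
rewrite grid_sum_chi -?lr2 -?lr // ifF //; apply/negbTE/asboolPn.
by rewrite opprK => /ballN; rewrite opprK.
Qed.

End KernelWeights.

(** * The eigenvalue of a radial kernel, and the delta and power kernels *)

Section RieszKernel.
Variables (R : realType) (p : nat) (p_pr : prime p).
Local Notation K := (padic p_pr).
Local Notation B k x := (@padic_ball p p_pr 0 k x).
Local Notation C := R[i].
Local Notation pC := (p%:R : C).
Local Notation g := (@char_ball R p p_pr).
Local Notation norm := (@padic_norm p p_pr R).
Implicit Types (k l j m : int) (r : nat) (x c : K) (s : C) (w T : int -> C).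

Let pC0 : pC != 0. Proof. exact: pC_neq0. Qed.
Let pR_gt0 : 0 < p%:R :> R. Proof. by rewrite ltr0n prime_gt0. Qed.
Let pR_gt1 : 1 < p%:R :> R. Proof. by rewrite ltr1n prime_gt1. Qed.

Lemma kernel_sum_char_ball w T k c x l r : kernel_mass p w T -> ~ B k c ->
  l <= - k -> - pval c <= l + r%:Z ->
  pC ^ (- (l + r%:Z)) * kernel_sum w l r (fun y => g k c (x - y)) +
    T (l + r%:Z) * g k c x =
  g k c x * (T (- pval c) - pC ^ pval c * w (- pval c - 1)).
Proof.
move=> wT kc lk mK; set m := pval c; set kk := l + r%:Z.
have c0 := ballN_neq0 kc.
have mk : m < k by rewrite ltNge; apply/negP => /(pvalP k c0).
have E j := @char_ball_sum R p p_pr k c x l r j kc.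
have S0 : pC ^ (- kk) * kernel_sum_in w l r (fun y => g k c (x - y)) (- m) =
    g k c x * (T (- m) - T kk).
  apply: (kernel_sum_in_mass wT (j0 := - m)); last by rewrite lexx mK.
  move=> j /andP[mj jk]; rewrite E // -/m; last by rewrite jk andbT; lia.
  by rewrite mj.
(* The ball sum is zero at level [- m - 1] and full at level [- m], so this single sphere
   contributes the opposite of the smaller ball; beyond it both vanish. *)
have S1 : kernel_sum_in w l r (fun y => g k c (x - y)) (- m - 1) =
    kernel_sum_in w l r (fun y => g k c (x - y)) (- m) -
    w (- m - 1) * (g k c x * pC ^ (kk + m)).
  rewrite kernel_sum_inS; last by rewrite -/kk; lia.
  rewrite subrK !E //; [|lia..]; rewrite -/m lexx ifF; last by lia.
  by rewrite mulr0 sub0r mulrN opprK.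
have S2 j : l <= j <= - m - 1 -> kernel_sum_in w l r (fun y => g k c (x - y)) j =
    kernel_sum_in w l r (fun y => g k c (x - y)) (- m - 1).
  move=> /andP[lj jm].
  have [d jE] : exists d : nat, j = - m - 1 - d%:Z by exists (absz (- m - 1 - j)%R); lia.
  elim: d => [|d IH] in j jE lj jm *; first by rewrite jE subr0.
  rewrite kernel_sum_inS; last by rewrite -/kk; lia.
  rewrite IH; [|lia..]; rewrite !E //; [|lia..].
  by rewrite !ifF; [rewrite subrr mulr0 addr0| rewrite -/m; lia..].
rewrite -kernel_sum_inT S2; last by lia.
rewrite S1 mulrBr S0 (expfzDr kk m pC0).
have pkk : pC ^ (- kk) * pC ^ kk = 1 by rewrite -expfzDr // addNr.
have aux (u v a b q t tk : C) : u * v = 1 ->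
    b * (t - tk) - u * (a * (b * (v * q))) + tk * b = b * (t - q * a).
  by move=> uv; transitivity (b * t - u * v * (a * b * q)); [ring|rewrite uv; ring].
exact: aux pkk.
Qed.

Lemma cpowD (a b : C) : cpow p%:R (a + b) = cpow p%:R a * cpow p%:R b :> C.
Proof. by rewrite /cpow mulrDl cexpD. Qed.

Lemma cpow1 : cpow (p%:R : R) 1 = pC.
Proof.
rewrite /cpow mul1r cexpE /= cos0 sin0 lnK ?posrE // mulr1 mulr0.
by rewrite -(rmorph_nat (real_complex R)).
Qed.

Let ln_neq0 : (ln p%:R : R)%:C != 0.
Proof. by rewrite fmorph_eq0 gt_eqF // ln_gt0. Qed.

Let complex_2pi_int j : (2 * pi * j%:~R)%:C = (2 * pi)%:C * j%:~R :> C.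
Proof. by rewrite rmorphM rmorph_int. Qed.

Lemma cpow_pole j : cpow (p%:R : R) (riesz_pole R p j) = 1.
Proof.
rewrite /cpow /riesz_pole -mulrA [j%:~R * _]mulrC mulrA mulfVK //.
by rewrite -[RHS](cexp_2pi_int _ j) complex_2pi_int; congr cexp; ring.
Qed.

Lemma cpow_eq1 (a : C) : cpow (p%:R : R) a = 1 -> exists j, a = riesz_pole R p j.
Proof.
move=> /cexp_eq1[j aj]; exists j.
apply: (mulIf ln_neq0); rewrite aj /riesz_pole complex_2pi_int.
by rewrite [RHS]mulrAC mulfVK //; ring.
Qed.

Lemma riesz_poleN j : riesz_pole R p (- j) = - riesz_pole R p j.
Proof. by rewrite /riesz_pole mulrNz mulrN. Qed.

Section Representation.
Variable mu : {measure set (borel K) -> \bar R}.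
Hypothesis haar_mu : is_haar mu.

(** The bounds [l <= 0 <= l + r] make the unit ball, at which [norm_power] is cut, a union of
    classes of the grid. *)
Definition kernel_integral (F : (K -> C) -> C) w T :=
  forall l r (phi : K -> C), l <= 0 -> 0 <= l + r%:Z ->
    ball_periodic (l + r%:Z) phi -> (forall x, phi x != 0 -> B l x) ->
    F phi = pC ^ (- (l + r%:Z)) * kernel_sum w l r phi + T (l + r%:Z) * phi 0.

(** The predicate [P] selects whole classes of the grid: those inside the unit ball, outside it, or
    all. As [f] vanishes on the small ball, the singularity never enters. *)
Lemma has_cintegral_kernel (D : set K) (P : K -> Prop) w l r (phi f : K -> C) :
  measurable (D : set (borel K)) ->
  (forall x y, ~ B (l + r%:Z) x -> P x -> B (l + r%:Z) (y - x) -> D y) ->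
  ball_periodic (l + r%:Z) phi ->
  (forall x, D x -> ~ B (l + r%:Z) x -> P x -> B l x -> f x = w (pval x) * phi x) ->
  (forall x, D x -> B (l + r%:Z) x \/ ~ P x \/ ~ B l x -> f x = 0) ->
  (forall x y, ~ B (l + r%:Z) x -> B (l + r%:Z) (y - x) -> P x <-> P y) ->
  has_cintegral mu D f (pC ^ (- (l + r%:Z)) *
    \sum_(t < p ^ r | ~~ `[< B (l + r%:Z) (grid p_pr l t) >] && `[< P (grid p_pr l t) >])
      w (pval (grid p_pr l t)) * phi (grid p_pr l t)).
Proof.
set k := l + r%:Z => mD PD phik fw f0 PP.
have -> : pC ^ (- k) = (p%:R ^ (- k) : R)%:C by rewrite real_complexXz rmorph_nat.
apply: (@has_cintegral_partition _ _ _ mu D _ _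
  (fun t => padic_ball (grid p_pr l t) k)) => //.
- by move=> t _; exact: measurable_padic_ball.
- move=> t /andP[/asboolPn tk /asboolP Pt] x /padic_ballE; exact: PD.
- by move=> t _; exact: haar_padic_ball.
- move=> t t' x /padic_ballE xt /padic_ballE xt'; apply: (@grid_inj _ p_pr l).
  by rewrite -(subrKA x); apply: ballD => //; exact: ballBC.
- move=> t x /andP[/asboolPn tk /asboolP Pt] /padic_ballE xt.
  have xk : ~ B k x.
    move=> xk; apply: tk; rewrite -(subKr x (grid p_pr l t)); exact: ballB.
  rewrite fw //.
  + by rewrite (pval_congr tk xt) (phik _ _ xt).
  + exact: PD tk Pt xt.
  + exact/(PP _ _ tk xt).
  + rewrite -(subrK (grid p_pr l t) x); apply: ballD; last exact: grid_ball.
    by apply: ball_le xt; rewrite /k; lia.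
move=> x Dx nx; apply: f0 => //.
have [xk|xk] := pselect (B k x); [by left|right].
have [Px|Px] := pselect (P x); [right => xl|by left].
have [t tP] := grid_ex r xl.
have tk : ~ B k (grid p_pr l t).
  by move=> tk; apply: xk; rewrite -(subrK (grid p_pr l t) x); exact: ballD.
apply: (nx t); last exact/padic_ballE.
apply/andP; split; first exact/asboolPn.
by apply/asboolP/(PP _ _ tk tP).
Qed.

Lemma cpow_subr1 s : cpow p%:R (s - 1) = (pC * cpow p%:R (- s))^-1.
Proof.
have v1 : cpow (p%:R : R) (s - 1) != 0 by exact: cexp_neq0.
apply: invr_inj; rewrite invrK; apply: (mulfI v1); rewrite (mulfV v1).
rewrite -cpow1 -!cpowD -[LHS](cpow_pole 0) /riesz_pole mulr0.
by congr cpow; ring.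
Qed.

Lemma norm_power_weightE s j :
  cpow p%:R (s - 1) ^ (- j) = pC ^ j * cpow p%:R (- s) ^ j.
Proof. by rewrite cpow_subr1 exprz_inv opprK expfzMl. Qed.

(** For [Re s > 0] this mass is the integral of [|z|^(s - 1)] over [p^j Z_p], a geometric series of
    ratio [p^(-s)]; the formula continues it to other [s]. *)
Lemma norm_power_mass s : cpow (p%:R : R) (- s) != 1 ->
  kernel_mass p (fun j => cpow p%:R (s - 1) ^ (- j))
    (fun j => (1 - pC^-1) / (1 - cpow p%:R (- s)) * cpow p%:R (- s) ^ j).
Proof.
move=> s1 j; rewrite norm_power_weightE.
have v0 : cpow (p%:R : R) (- s) != 0 by exact: cexp_neq0.
rewrite (expfzDr j 1 v0) expr1z.
have pp : pC ^ (- j) * pC ^ j = 1 by rewrite -expfzDr // addNr.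
have aux (u v a x y : C) : 1 - a != 0 -> u * v = 1 ->
    x / (1 - a) * y - x / (1 - a) * (y * a) = x * u * (v * y).
  move=> a1 uv; transitivity (x * (u * v) * y); [rewrite uv; field|ring].
  exact: a1.
by apply: aux => //; rewrite subr_eq0 eq_sym.
Qed.

Lemma norm_power_kernel s : cpow (p%:R : R) (- s) != 1 ->
  let G := (1 - pC^-1) / (1 - cpow p%:R (- s)) in
  kernel_integral (norm_power mu s) (fun j => cpow p%:R (s - 1) ^ (- j))
    (fun j => G * cpow p%:R (- s) ^ j).
Proof.
move=> s1 G; set w := fun j => _; set T := fun j => _.
have wT : kernel_mass p w T by exact: norm_power_mass.
move=> l r phi l0 k0 phik phil; set k := l + r%:Z.
have BB x y (i : int) : i <= k -> B k (y - x) -> B i x <-> B i y.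
  move=> ik xy; have xy' : B i (y - x) by exact: ball_le xy.
  by rewrite -[y](subrK x); symmetry; exact: ballDr.
have H1 : has_cintegral mu (@unit_ball R p p_pr)
    (fun z => cpow (norm z) (s - 1) * (phi z - phi 0))
    (pC ^ (- k) * \sum_(t < p ^ r |
        ~~ `[< B k (grid p_pr l t) >] && `[< B 0 (grid p_pr l t) >])
      w (pval (grid p_pr l t)) * (phi (grid p_pr l t) - phi 0)).
  rewrite unit_ballE.
  apply: (has_cintegral_kernel (P := fun x => B 0 x) (phi := fun x => phi x - phi 0)).
  - exact: measurable_padic_ball.
  - by move=> x y _ x0 xy; apply/(BB x y 0).
  - by move=> x y xy; rewrite (phik _ _ xy).
  - move=> x _ xk _ _; rewrite cpow_padic_norm //; exact: ballN_neq0 xk.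
  - move=> x x0 [xk|[//|nxl]]; last by case: nxl; apply: ball_le x0.
    by rewrite (phik 0 x) ?subrr ?mulr0 // subr0.
  - by move=> x y _ xy; apply: BB.
have H2 : has_cintegral mu (~` @unit_ball R p p_pr)
    (fun z => cpow (norm z) (s - 1) * phi z)
    (pC ^ (- k) * \sum_(t < p ^ r |
        ~~ `[< B k (grid p_pr l t) >] && `[< ~ B 0 (grid p_pr l t) >])
      w (pval (grid p_pr l t)) * phi (grid p_pr l t)).
  rewrite unit_ballE.
  apply: (has_cintegral_kernel (P := fun x => ~ B 0 x)).
  - by apply: measurableC; exact: measurable_padic_ball.
  - by move=> x y _ x0 xy /= y0; apply: x0; apply/(BB x y 0).
  - exact: phik.
  - move=> x _ xk _ _; rewrite cpow_padic_norm //; exact: ballN_neq0 xk.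
  - move=> x x0 [xk|[//|nxl]]; first by case: x0 => /=; apply: ball_le xk.
    have [->|/phil//] := eqVneq (phi x) 0; by rewrite mulr0.
  - by move=> x y _ xy; have := BB x y 0 k0 xy => H; split=> nx xx; apply: nx; apply/H.
rewrite /norm_power; case: H1 => _ _ ->; case: H2 => _ _ ->.
(* The regularization subtracts [phi 0] on the unit ball outside [p^k Z_p], which costs
   [phi 0 * (T 0 - T k)], and adds [phi 0 * T 0]; exactly [phi 0 * T k] remains. *)
have one : pC ^ (- k) * kernel_sum_in w l r (fun _ : K => 1) 0 = T 0 - T k.
  rewrite -(mul1r (T 0 - T k)); apply: (kernel_sum_in_mass wT (j0 := 0));
    last by rewrite lexx k0.
  move=> j /andP[j0 jk]; rewrite mul1r /ball_sum.
  have [r' lr] : exists r' : nat, l + r%:Z = j + r'%:Z by exists (absz (k - j)%R); lia.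
  rewrite (grid_sum_ball (f := fun _ : K => 1) lr) //; last by lia.
  by rewrite sumr_const card_ord natrX exprnP; congr (_ ^ _); lia.
rewrite /kernel_sum [in RHS](bigID (fun t => `[< B 0 (grid p_pr l t) >])) /=.
have -> : \sum_(t < p ^ r | ~~ `[< B k (grid p_pr l t) >] && `[< B 0 (grid p_pr l t) >])
    w (pval (grid p_pr l t)) * (phi (grid p_pr l t) - phi 0) =
  \sum_(t < p ^ r | ~~ `[< B k (grid p_pr l t) >] && `[< B 0 (grid p_pr l t) >])
    w (pval (grid p_pr l t)) * phi (grid p_pr l t) -
    kernel_sum_in w l r (fun _ : K => 1) 0 * phi 0.
  rewrite /kernel_sum_in mulr_suml -sumrB; apply: eq_bigr => t _.
  by rewrite mulr1 mulrBr.
have -> : \sum_(t < p ^ r | ~~ `[< B k (grid p_pr l t) >] && `[< ~ B 0 (grid p_pr l t) >])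
    w (pval (grid p_pr l t)) * phi (grid p_pr l t) =
  \sum_(t < p ^ r | ~~ `[< B k (grid p_pr l t) >] && ~~ `[< B 0 (grid p_pr l t) >])
    w (pval (grid p_pr l t)) * phi (grid p_pr l t).
  by apply: eq_bigl => t; rewrite asbool_neg.
have T0 : T 0 = G by rewrite /T expr0z mulr1.
have aux (u a b f x t0 tk : C) : u * x = t0 - tk ->
    u * (a - x * f) + u * b + f * t0 = u * (a + b) + tk * f.
  move=> ux; transitivity (u * a - u * x * f + u * b + f * t0); first by ring.
  by rewrite ux; ring.
by apply: aux; rewrite one T0.
Qed.

Lemma riesz_delta_kernel : kernel_integral (fun phi => phi 0) (fun=> 0) (fun=> 1).
Proof.
move=> l r phi _ _ _ _; rewrite /kernel_sum big1 ?mulr0 ?add0r ?mul1r //.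
by move=> t _; rewrite mul0r.
Qed.

End Representation.
End RieszKernel.

(** * The logarithmic kernel *)

Section LogKernel.
Variables (R : realType) (p : nat) (p_pr : prime p).
Local Notation K := (padic p_pr).
Local Notation B k x := (@padic_ball p p_pr 0 k x).
Local Notation C := R[i].
Local Notation pR := (p%:R : R).
Local Notation norm := (@padic_norm p p_pr R).
Variable mu : {measure set (borel K) -> \bar R}.
Hypothesis haar_mu : is_haar mu.
Implicit Types (k l j : int) (r : nat).

Let pR_gt0 : 0 < pR. Proof. by rewrite ltr0n prime_gt0. Qed.
Let pR_gt1 : 1 < pR. Proof. by rewrite ltr1n prime_gt1. Qed.
Let pR_neq0 : pR != 0. Proof. by rewrite gt_eqF. Qed.

Lemma measurable_padic0 : measurable ([set 0] : set (borel K)).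
Proof.
have -> : [set 0] = \bigcap_(i : nat) (padic_ball 0 i : set K).
  apply/seteqP; split=> [x -> i _|x xB]; first exact: ball0.
  apply: padic_ball_inter0 => k; apply: ball_le (xB `|k|%N I); lia.
by apply: bigcap_measurable => // i _; exact: measurable_padic_ball.
Qed.

Lemma haar_padic0 : mu [set 0] = 0%E.
Proof.
apply/eqP; rewrite eq_le measure_ge0 andbT; apply/lee_addgt0Pr => e e0.
have [k ke] := padic_pow_small p_pr e0.
rewrite add0e; apply: (@le_trans _ _ (mu (padic_ball 0 k))).
  apply: le_measure; rewrite ?inE; [exact: measurable_padic0|exact: measurable_padic_ball|].
  by move=> x ->; exact: ball0.
by rewrite haar_padic_ball // lee_fin -exprnN.
Qed.

(** The origin, a null set, is removed because [pval 0] is arbitrary. *)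
Definition pball0 k : set K := padic_ball 0 k `\ 0.

Lemma measurable_pball0 k : measurable (pball0 k : set (borel K)).
Proof. exact: measurableD (measurable_padic_ball 0 k) measurable_padic0. Qed.

Lemma haar_pball0 k : mu (pball0 k) = (pR ^ (- k))%:E.
Proof.
have dis : pball0 k `&` [set 0] = set0 by rewrite setIC; exact: setDIK.
rewrite -(haar_padic_ball haar_mu 0 k).
transitivity (mu (pball0 k) + mu [set 0%R])%E; first by rewrite haar_padic0 adde0.
rewrite -(measureU mu (measurable_pball0 k) measurable_padic0 dis); congr (mu _).
by rewrite setUC /pball0 setDUK // => x ->; exact: ball0.
Qed.

Definition pval_above k (x : K) : R := if `[< pball0 k x >] then (pval x - k)%:~R else 0.

(** Layer by layer: the excess of the valuation over [k] counts the smaller punctured balls that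
    contain [x]. Integrating term by term then gives a geometric series. *)
Lemma pval_above_series k x :
  (pval_above k x)%:E = (\sum_(i <oo) (\1_(pball0 (k + 1 + i%:Z)) x)%:E)%E.
Proof.
pose N := if `[< pball0 k x >] then `|pval x - k|%N else 0%N.
have NE i : \1_(pball0 (k + 1 + i%:Z)) x = (i < N)%N%:R :> R.
  rewrite indicE /N; congr (_%:R); congr nat_of_bool.
  have [x0|x0] := eqVneq x 0.
    rewrite memNset; last by move=> [_ /= /(_ x0)].
    by case: asboolP => // -[_ /= /(_ x0)].
  case: asboolP => [[xk _]|xk].
    move: xk => /(pvalP _ x0) xk.
    apply/idP/idP => [/set_mem[/(pvalP _ x0)]|H]; first by lia.
    apply/mem_set; split; last exact/eqP.
    by apply/(pvalP _ x0); lia.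
  rewrite ltn0; apply/negbTE/negP => /set_mem[xB _]; apply: xk; split; last exact/eqP.
  by apply: ball_le xB; lia.
symmetry; apply: cvg_lim => //; apply: cvg_near_cst.
exists N => // n /= Nn.
under eq_bigr do rewrite NE.
rewrite sumEFin -natr_sum /pval_above.
have -> : (\sum_(0 <= i < n) (i < N))%N = N.
  transitivity (minn n N); last by apply/minn_idPr.
  elim: n {Nn} => [|n IH]; first by rewrite big_geq // min0n.
  by rewrite big_nat_recr //= IH; lia.
rewrite /N; case: asboolP => // -[xk x0]; congr (_%:E).
move: xk => /(pvalP _ _) xk.
rewrite pmulrn; congr (_%:~R); apply: gez0_abs.
rewrite subr_ge0; apply: xk; exact/eqP.
Qed.

Lemma has_cintegral_pval_above k :
  has_cintegral mu setT (fun x => (pval_above k x)%:C)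
    (pR ^ (- (k + 1)) / (1 - pR^-1))%:C.
Proof.
have mf i : measurable_fun setT (fun x : borel K => (\1_(pball0 (k + 1 + i%:Z)) x : R)%:E).
  apply/measurable_EFinP; apply: measurable_indic.
  exact: measurable_pball0.
have f0 i x : (0 <= (\1_(pball0 (k + 1 + i%:Z)) x : R)%:E)%E by rewrite lee_fin.
have I : (\int[mu]_x (pval_above k x)%:E = (pR ^ (- (k + 1)) / (1 - pR^-1))%:E)%E.
  under eq_integral do rewrite pval_above_series.
  rewrite integral_nneseries //.
  rewrite (eq_eseriesr (g := fun i => (geometric (pR ^ (- (k + 1))) pR^-1 i)%:E)); last first.
    move=> i _; rewrite integral_indic //; last exact: measurable_pball0.
    rewrite setIT haar_pball0 /geometric /=; congr EFin.
    by rewrite opprD expfzDr // exprVn exprnN.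
  have H : series (geometric (pR ^ (- (k + 1))) pR^-1) @ \oo -->
      pR ^ (- (k + 1)) / (1 - pR^-1).
    apply: cvg_geometric_series.
    by rewrite ger0_norm ?invr_ge0 ?ltW // invf_lt1.
  have -> : (fun n => \sum_(0 <= i < n) (geometric (pR ^ (- (k + 1))) pR^-1 i)%:E)%E =
      EFin \o series (geometric (pR ^ (- (k + 1))) pR^-1).
    by apply/funext => n; rewrite /= sumEFin.
  by rewrite EFin_lim; [congr EFin; exact: cvg_lim|apply/cvg_ex; eexists; exact: H].
have i1 : mu.-integrable setT (EFin \o pval_above k).
  apply/integrableP; split.
    rewrite (_ : _ \o _ = fun x => (\sum_(i <oo) (\1_(pball0 (k + 1 + i%:Z)) x)%:E)%E).
      exact: ge0_emeasurable_sum.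
    by apply/funext => x /=; rewrite pval_above_series.
  rewrite (eq_integral (fun x : borel K => (pval_above k x)%:E)); first by rewrite I ltry.
  move=> x _ /=; rewrite ger0_norm // -lee_fin pval_above_series.
  by apply: nneseries_ge0.
have := has_cintegral_real measurableT i1.
by rewrite /Rintegral I.
Qed.

Local Notation pC := (p%:R : C).

Let pC0 : pC != 0. Proof. exact: pC_neq0. Qed.

Definition log_weight (j : int) : C := (1 - pC^-1) * j%:~R.
(** The integral of [log_weight] composed with the valuation over [p^j Z_p]: [1 - 1/p] times the sum
    of [j p^(-j)] and the mean excess [p^(-(j + 1)) / (1 - 1/p)]. *)
Definition log_mass (j : int) : C := pC ^ (- j) * ((1 - pC^-1) * j%:~R + pC^-1).

Lemma log_kernel_mass : kernel_mass p log_weight log_mass.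
Proof.
move=> j; rewrite /log_mass /log_weight opprD (expfzDr _ _ pC0) intrD.
by rewrite (_ : pC ^ (- 1) = pC^-1) //; field.
Qed.

Lemma log_kernel_value m : log_mass (- m) - pC ^ m * log_weight (- m - 1) = pC ^ m.
Proof.
by rewrite /log_mass /log_weight opprK intrB mulrNz; field.
Qed.

Lemma log_norm_weight x : x != 0 ->
  (- ((1 - pR^-1) / ln pR) * ln (norm x))%:C = log_weight (pval x).
Proof.
move=> x0; rewrite ln_padic_norm // mulNr mulNr mulrN opprK.
have ln0 : ln pR != 0 by rewrite gt_eqF // ln_gt0.
rewrite mulrCA mulfVK // mulrC rmorphM rmorph_int rmorphB rmorph1 fmorphV.
by rewrite rmorph_nat.
Qed.

Lemma log_kernel : kernel_integral (fun phi => cintegral mu setT (fun z =>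
    (- ((1 - pR^-1) / ln pR) * ln (norm z))%:C * phi z)) log_weight log_mass.
Proof.
move=> l r phi l0 k0 phik phil; set k := l + r%:Z.
set f := fun z => _%:C * _.
have H1 : has_cintegral mu setT (fun z => if `[< B k z >] then 0 else f z)
    (pC ^ (- k) * \sum_(t < p ^ r |
        ~~ `[< B k (grid p_pr l t) >] && `[< True >])
      log_weight (pval (grid p_pr l t)) * phi (grid p_pr l t)).
  apply: (has_cintegral_kernel haar_mu (P := fun=> True)) => //.
  - move=> x _ xk _ _; rewrite ifF; last exact/negbTE/asboolPn.
    by rewrite /f log_norm_weight //; exact: ballN_neq0 xk.
  - move=> x _ [xk|[//|xl]]; first by rewrite ifT //; exact/asboolP.
    case: ifP => // _; rewrite /f.
    by have [->|/phil//] := eqVneq (phi x) 0; rewrite mulr0.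
(* On the small ball the valuation is split as [k] plus its excess over [k], both integrable. *)
have H2 : has_cintegral mu setT (fun z =>
      (1 - pC^-1) * ((pval_above k z)%:C + k%:~R * (\1_(pball0 k) z)%:C))
    (log_mass k).
  have -> : log_mass k = (1 - pC^-1) * ((pR ^ (- (k + 1)) / (1 - pR^-1))%:C +
      k%:~R * (fine (mu (pball0 k)))%:C).
    have p1 : 1 - pC^-1 != 0.
      by rewrite subr_eq0 eq_sym invr_eq1 pnatr_eq1 gtn_eqF // prime_gt1.
    have -> : fine (mu (pball0 k)) = pR ^ (- k) by rewrite haar_pball0.
    have -> : (pR ^ (- (k + 1)) / (1 - pR^-1))%:C = pC ^ (- (k + 1)) / (1 - pC^-1).
      transitivity ((pR ^ (- (k + 1)))%:C * ((1 - pR^-1)^-1)%:C).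
        exact: rmorphM.
      by rewrite real_complexXz fmorphV rmorphB rmorph1 fmorphV !rmorph_nat.
    rewrite real_complexXz rmorph_nat.
    rewrite /log_mass (opprD k 1) (expfzDr (- k) (- 1) pC0) (_ : pC ^ (- 1) = pC^-1) //.
    have aux (u q a : C) : 1 - q != 0 ->
        u * ((1 - q) * a + q) = (1 - q) * (u * q / (1 - q) + a * u).
      by move=> q1; field.
    exact: aux.
  apply: has_cintegralZ => //; apply: has_cintegralD => //.
    exact: has_cintegral_pval_above.
  apply: has_cintegralZ => //; apply: has_cintegral_indic => //.
    exact: measurable_pball0.
  by rewrite haar_pball0 ltry.
have H := has_cintegralD measurableT H1 (has_cintegralZ (phi 0) measurableT H2).
have /(eq_has_cintegral (g := f)) {}H := H.
case: H => [z _||_ _ ->] //.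
  case: asboolP => zk; rewrite /pval_above indicE.
    have [z0|z0] := eqVneq z 0.
      have nz : ~ pball0 k z by move=> [_ /= /(_ z0)].
      rewrite asboolF // memNset //.
      (* At the origin the convention [ln 0 = 0] makes the integrand vanish, as the punctured
         functions do. *)
      have l00 : ln (0 : R) = 0 by rewrite ln0.
      by rewrite /f z0 padic_norm0 l00 !(mulr0, rmorph0, mul0r, addr0).
    have zp : pball0 k z by split=> //; exact/eqP.
    rewrite asboolT // mem_set // mulr1 add0r /f log_norm_weight //.
    rewrite (phik 0 z) ?subr0 // /log_weight rmorph_int -intrD subrK.
    by rewrite mulrC.
  have nz : ~ pball0 k z by case.
  by rewrite asboolF // memNset // !(mulr0, rmorph0, mul0r, addr0).
rewrite [phi 0 * _]mulrC; congr (_ * _ + _).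
apply: eq_bigl => t; rewrite [X in _ && X](_ : _ = true) ?andbT //.
exact/asboolP.
Qed.

End LogKernel.

(** * The Vladimirov operator on Fourier transforms *)

Section Riesz1D.
Variables (R : realType) (p : nat) (p_pr : prime p).
Local Notation K := (padic p_pr).
Local Notation B k x := (@padic_ball p p_pr 0 k x).
Local Notation C := R[i].
Local Notation pC := (p%:R : C).
Local Notation g := (@char_ball R p p_pr).
Variable mu : {measure set (borel K) -> \bar R}.
Hypothesis haar_mu : is_haar mu.
Implicit Types (k l m : int) (r : nat) (x c : K) (s : C).

Let pC0 : pC != 0. Proof. exact: pC_neq0. Qed.

(** The three kernels share the eigenvalue [p^(s m)]: at a pole [p^s = 1], in agreement with the
    delta, and for the logarithm [p^s = p]. *)
Lemma riesz_kernel_ex s : exists w T,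
  [/\ kernel_integral (p_pr := p_pr) (riesz mu s) w T, kernel_mass p w T &
      forall m, T (- m) - pC ^ m * w (- m - 1) = cpow p%:R s ^ m].
Proof.
rewrite /kernel_integral /riesz; case: asboolP => [[j ->]|sp].
  exists (fun=> 0), (fun=> 1); split.
  - exact: riesz_delta_kernel.
  - by move=> j'; rewrite subrr mulr0.
  - by move=> m; rewrite mulr0 subr0 cpow_pole // exp1rz.
case: asboolP => [[j ->]|sp1].
  exists (log_weight R p), (log_mass R p); split.
  - exact: log_kernel.
  - exact: log_kernel_mass.
  - move=> m; rewrite (log_kernel_value R p_pr) cpowD.
    by rewrite (cpow1 R p_pr) (cpow_pole R p_pr) mulr1.
have u1 : cpow (p%:R : R) (- s) != 1.
  apply/eqP => /(cpow_eq1 p_pr)[j sj]; apply: sp; exists (- j).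
  by rewrite riesz_poleN -sj opprK.
have v1 : cpow (p%:R : R) (s - 1) != 1.
  apply/eqP => /(cpow_eq1 p_pr)[j sj]; apply: sp1; exists j.
  by rewrite -sj addrC subrK.
pose G : C := (1 - pC^-1) / (1 - cpow p%:R (- s)).
pose Gam := @padic_Gamma R p s.
have v0 : cpow (p%:R : R) (- s) != 0 by exact: cexp_neq0.
have Gam0 : Gam != 0.
  by rewrite mulf_neq0 ?invr_eq0 // subr_eq0 eq_sym.
exists (fun j => cpow p%:R (s - 1) ^ (- j) / Gam),
  (fun j => G * cpow p%:R (- s) ^ j / Gam); split.
- move=> l r phi l0 k0 phik phil.
  rewrite (norm_power_kernel haar_mu u1 l0 k0 phik phil) -/G -/Gam mulrDl.
  congr (_ + _); last by rewrite mulrAC.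
  rewrite -mulrA; congr (_ * _); rewrite /kernel_sum mulr_suml.
  by apply: eq_bigr => t _; rewrite mulrAC.
- move=> j; rewrite -mulrBl.
  by rewrite (norm_power_mass p_pr u1) mulrA.
move=> m; rewrite (norm_power_weightE p_pr).
have -> : cpow (p%:R : R) s = (cpow p%:R (- s))^-1 by rewrite /cpow mulNr cexpN invrK.
have GamE : Gam = (1 - (pC * cpow p%:R (- s))^-1) / (1 - cpow p%:R (- s)).
  by rewrite -(cpow_subr1 p_pr).
set v := cpow _ _ in v0 u1 G GamE *; clearbody v.
have v1' : 1 - v != 0 by rewrite subr_eq0 eq_sym.
(* Before normalization the eigenvalue is [(G - 1/(p v)) v^m] with [v = p^(-s)] at level [- m], that
   is [Gam * p^(s m)]; division by [padic_Gamma] removes the constant. *)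
have GG : G - pC^-1 * v^-1 = Gam.
  by rewrite GamE /G; field; rewrite v1' v0.
rewrite !(expfzDr (- m) (- 1)) // exprz_inv.
rewrite (_ : pC ^ (- 1) = pC^-1) // (_ : v ^ (- 1) = v^-1) //.
have pp : pC ^ m * pC ^ (- m) = 1 by rewrite -expfzDr // subrr.
have aux (P Pn V q u : C) : P * Pn = 1 ->
    G * V / Gam - P * (Pn * q * (V * u) / Gam) = (G - q * u) * V / Gam.
  move=> PP; transitivity (G * V / Gam - (P * Pn) * (q * (V * u) / Gam)); first by ring.
  by rewrite PP mul1r !mulrBl; ring.
by rewrite (aux _ _ _ _ _ pp) GG mulrC mulKf.
Qed.

Definition schwartz1 (f : K -> C) := exists N : nat,
  ball_periodic N f /\ forall x, f x != 0 -> B (- N%:Z) x.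

(** At a scale common to all [h i] the pairing is a finite sum, so linearity needs no integrability
    argument. *)
Lemma riesz_sum s (I : finType) (a : I -> C) (h : I -> K -> C) :
  (forall i, schwartz1 (h i)) ->
  riesz mu s (fun z => \sum_i a i * h i z) = \sum_i a i * riesz mu s (h i).
Proof.
have [w [T [sT _ _]]] := riesz_kernel_ex s.
move=> /choice[N NP]; pose M := (\max_i N i)%N.
have NM i : (N i <= M)%N by exact: leq_bigmax.
have hp i : ball_periodic M (h i).
  move=> x y xy; have [+ _] := NP i; apply; apply: ball_le xy.
  by rewrite lez_nat.
have hs i x : h i x != 0 -> B (- M%:Z) x.
  by have [_ H] := NP i; move=> /H; apply: ball_le; rewrite lerN2 lez_nat.
have MM : - M%:Z + (M + M)%N%:Z = M%:Z by lia.
have F (f : K -> C) : ball_periodic M f -> (forall x, f x != 0 -> B (- M%:Z) x) ->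
    riesz mu s f = pC ^ (- M%:Z) * kernel_sum w (- M%:Z) (M + M) f + T M * f 0.
  move=> fp fs; have := sT (- M%:Z) (M + M)%N f; rewrite MM; apply => //; lia.
rewrite F; first last.
- move=> x; have [//|nx] := pselect (B (- M%:Z) x).
  rewrite big1 ?eqxx // => i _.
  by have [->|/hs//] := eqVneq (h i x) 0; rewrite mulr0.
- by move=> x y xy; apply: eq_bigr => i _; rewrite (hp i _ _ xy).
have -> : kernel_sum w (- M%:Z) (M + M) (fun z => \sum_i a i * h i z) =
    \sum_i a i * kernel_sum w (- M%:Z) (M + M) (h i).
  rewrite /kernel_sum; under eq_bigr do rewrite mulr_sumr.
  rewrite exchange_big; apply: eq_bigr => i _; rewrite mulr_sumr.
  by apply: eq_bigr => t _; rewrite mulrCA.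
rewrite !mulr_sumr -big_split; apply: eq_bigr => i _ /=.
by rewrite (F _ (hp i) (hs i)) mulrDr; congr (_ + _); rewrite mulrCA.
Qed.

Lemma schwartz1_char_ball k c x : schwartz1 (fun y => g k c (x - y)).
Proof.
have [i ic] := ball_ex c; have [j jx] := ball_ex x.
exists (absz k + absz i + absz j)%N; split.
  apply: char_ball_periodic; first lia.
  by apply: ball_le ic; lia.
move=> y y0; rewrite -(subKr x y); apply: ballB; first by apply: ball_le jx; lia.
have [yk|yk] := pselect (B (- k) (x - y)); first by apply: ball_le yk; lia.
by rewrite char_ball_out ?eqxx in y0.
Qed.

Lemma riesz_char_ball s k c x : ~ B k c ->
  riesz mu s (fun y => g k c (x - y)) = cpow p%:R s ^ pval c * g k c x.
Proof.
move=> kc; have c0 := ballN_neq0 kc.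
have [w [T [sT wT vT]]] := riesz_kernel_ex s.
have [N [Np Ns]] := schwartz1_char_ball k c x.
pose M := (N + absz k + absz (pval c))%N.
have MM : - M%:Z + (M + M)%N%:Z = M%:Z by lia.
rewrite (sT (- M%:Z) (M + M)%N); first last.
- by move=> y /Ns; apply: ball_le; rewrite /M; lia.
- by move=> y z yz; apply: Np; apply: ball_le yz; rewrite /M; lia.
- by rewrite MM.
- by lia.
rewrite subr0 kernel_sum_char_ball // ?MM; [|rewrite /M; lia..].
by rewrite vT mulrC.
Qed.

End Riesz1D.

Section DirectProduct.
Variables (R : realType) (p : nat) (p_pr : prime p).
Local Notation K := (padic p_pr).
Local Notation C := R[i].

(** Linearity is required only on combinations of the given factors, since an integral is not
    additive on arbitrary functions. *)
Lemma direct_product_sum n (f : 'I_n -> (K -> C) -> C) (I : finType)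
    (a : I -> C) (h : I -> 'I_n -> K -> C) :
  (forall j (b : I -> C), f j (fun z => \sum_t b t * h t j z) =
     \sum_t b t * f j (h t j)) ->
  direct_product f (fun y => \sum_t a t * \prod_j h t j (y 0 j)) =
  \sum_t a t * \prod_j f j (h t j).
Proof.
elim: n => [|n IH] in f a h *.
  by move=> _ /=; apply: eq_bigr => t _; rewrite !big_ord0.
move=> flin /=.
have inner z : direct_product (fun i : 'I_n => f (lift ord0 i))
    (fun y => \sum_t a t * \prod_j h t j ((row_mx (const_mx z : 'rV[K]_1) y) 0 j)) =
    \sum_t (a t * \prod_j f (lift ord0 j) (h t (lift ord0 j))) * h t ord0 z.
  have -> : (fun y : 'rV[K]_n => \sum_t a t *
        \prod_j h t j ((row_mx (const_mx z : 'rV[K]_1) y) 0 j)) =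
      (fun y => \sum_t (a t * h t ord0 z) * \prod_j h t (lift ord0 j) (y 0 j)).
    apply/funext => y; apply: eq_bigr => t _; rewrite big_ord_recl -mulrA.
    congr (_ * (_ * _)).
      have -> : (ord0 : 'I_(1 + n)) = lshift n ord0 by apply: val_inj.
      by rewrite row_mxEl mxE.
    apply: eq_bigr => j _; congr (h _ _ _).
    have -> : lift ord0 j = rshift 1 j by apply: val_inj.
    by rewrite row_mxEr.
  rewrite (IH _ _ (fun t j => h t (lift ord0 j))); last by move=> j b; exact: flin.
  by apply: eq_bigr => t _; rewrite mulrAC.
rewrite (_ : (fun z => _) = (fun z => \sum_t
    (a t * \prod_j f (lift ord0 j) (h t (lift ord0 j))) * h t ord0 z)); last first.
  by apply/funext => z; exact: inner.
rewrite flin; apply: eq_bigr => t _.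
by rewrite big_ord_recl -mulrA; congr (_ * _); rewrite mulrC.
Qed.

End DirectProduct.

(** * Multiplication by powers of the coordinate norms *)

Section Multiplier.
Variables (R : realType) (p : nat) (p_pr : prime p).
Local Notation K := (padic p_pr).
Local Notation B k x := (@padic_ball p p_pr 0 k x).
Local Notation C := R[i].
Local Notation norm := (@padic_norm p p_pr R).
Variables (mu : {measure set (borel K) -> \bar R}) (haar_mu : is_haar mu).
Variables (n : nat) (mun : {measure set (borel 'rV[K]_n) -> \bar R}).
Hypothesis mun_power : is_power_measure mu mun.
Implicit Types (alpha : 'I_n -> C) (psi : 'rV[K]_n -> C).

Definition norm_multiplier alpha psi (x : 'rV[K]_n) : C :=
  (\prod_i cpow (norm (x 0 i)) (alpha i)) * psi x.

(** The identity holds even on the axes: [ln 0 = 0] gives the power the value 1 there. *)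
Lemma norm_multiplierNK alpha psi :
  norm_multiplier alpha (norm_multiplier (fun i => - alpha i) psi) = psi.
Proof.
apply/funext => x; rewrite /norm_multiplier mulrA -big_split /= big1 ?mul1r //.
by move=> i _; rewrite /cpow mulNr cexpNK.
Qed.

Lemma norm_multiplier_eq0 alpha psi x :
  (norm_multiplier alpha psi x == 0) = (psi x == 0).
Proof.
rewrite /norm_multiplier mulf_eq0 (negPf (_ : _ != 0)) //.
by apply/prodf_neq0 => i _; exact: cexp_neq0.
Qed.

(** A coordinate in [p^N Z_p] can be replaced by 0 without leaving the box, so [psi] would vanish
    there. *)
Lemma Psi_off_axes psi (N : int) : lizorkin_Psi psi -> vball_periodic N psi ->
  forall x, psi x != 0 -> forall i, ~ B N (x 0 i).
Proof.
move=> [_ psi0] psiN x x0 i xi; move: x0; apply/negP; rewrite negbK.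
pose y : 'rV[K]_n := \row_j if j == i then 0 else x 0 j.
rewrite -(psiN x y); first by apply/eqP; apply: (psi0 i); rewrite mxE eqxx.
apply: vballI => j; rewrite mxE; case: eqP => [->|_]; last first.
  by rewrite subrr; exact: ball0.
by rewrite sub0r; exact: ballN.
Qed.

Lemma norm_multiplier_periodic alpha psi (N : int) :
  lizorkin_Psi psi -> vball_periodic N psi ->
  vball_periodic N (norm_multiplier alpha psi).
Proof.
move=> psiP psiN x y xy; rewrite /norm_multiplier (psiN _ _ xy).
have [->|x0] := eqVneq (psi x) 0; first by rewrite !mulr0.
have normE i : norm (y 0 i) = norm (x 0 i).
  have xi := Psi_off_axes psiP psiN x0 (i := i).
  have yi : ~ B N (y 0 i).
    by apply: (Psi_off_axes psiP psiN); rewrite (psiN _ _ xy).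
  rewrite (padic_normE R (ballN_neq0 xi)) (padic_normE R (ballN_neq0 yi)).
  by rewrite (pval_congr xi (vballE i xy)).
by under eq_bigr do rewrite normE.
Qed.

Lemma norm_multiplier_Psi alpha psi :
  lizorkin_Psi psi -> lizorkin_Psi (norm_multiplier alpha psi).
Proof.
move=> psiP; have [psit psi0] := psiP; split; last first.
  by move=> j xi xj; apply/eqP; rewrite norm_multiplier_eq0 (psi0 j).
have [N [psiN _]] := test_function_uniform psit.
split.
  move=> x; apply/nbhs_vball; exists N => y xy.
  exact: (norm_multiplier_periodic alpha psiP psiN).
rewrite (_ : [set x | _] = [set x | psi x != 0]); first exact: psit.2.
by apply/seteqP; split=> x /=; rewrite norm_multiplier_eq0.
Qed.

Lemma vladimirov_fourier alpha psi : lizorkin_Psi psi ->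
  vladimirov mu alpha (fourier mun psi) = fourier mun (norm_multiplier alpha psi).
Proof.
move=> psiP; have [psit _] := psiP.
have [N [psiN psiS]] := test_function_uniform psit.
have NN : - N%:Z + (N + N)%N%:Z = N%:Z by lia.
have multS x : norm_multiplier alpha psi x != 0 -> vball 0 (- N%:Z) x.
  by rewrite norm_multiplier_eq0; exact: psiS.
have multN := norm_multiplier_periodic alpha psiP psiN.
have FE xi := @fourier_grid _ _ _ _ haar_mu _ _ mun_power psi (- N%:Z) (N + N)%N xi.
apply/funext => x.
have := @fourier_grid _ _ _ _ haar_mu _ _ mun_power _ (- N%:Z) (N + N)%N x _ multS.
rewrite NN => /(_ multN) ->.
rewrite /vladimirov /multi_riesz.
pose a (t : {ffun 'I_n -> 'I_(p ^ (N + N))}) :=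
  (p%:R ^ (- N%:Z)) ^+ n * psi (vgrid p_pr (- N%:Z) t) : C.
pose h (t : {ffun 'I_n -> 'I_(p ^ (N + N))}) (i : 'I_n) (y : K) :=
  char_ball R N (grid p_pr (- N%:Z) (t i)) (x 0 i - y).
rewrite (_ : (fun xi => _) = (fun y : 'rV[K]_n =>
    \sum_t a t * \prod_i h t i (y 0 i))); last first.
  apply/funext => y; rewrite FE ?NN // mulr_sumr; apply: eq_bigr => t _.
  rewrite mulrA; congr (_ * _); apply: eq_bigr => i _; rewrite /h.
  by rewrite !mxE.
rewrite direct_product_sum; last first.
  move=> j b; apply: (riesz_sum haar_mu) => t; exact: schwartz1_char_ball.
rewrite mulr_sumr; apply: eq_bigr => t _; rewrite /a -!mulrA; congr (_ * _).
(* The eigenvector relation needs a grid point away from the axes; only points with nonzero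
   coefficient are known to be so. *)
have [t0|t0] := eqVneq (psi (vgrid p_pr (- N%:Z) t)) 0.
  by rewrite /norm_multiplier t0 !(mulr0, mul0r).
rewrite /norm_multiplier [RHS]mulrCA; congr (_ * _).
rewrite -big_split /=; apply: eq_bigr => i _.
have ti := Psi_off_axes psiP psiN t0 (i := i); rewrite mxE in ti.
rewrite /h (riesz_char_ball haar_mu) // mxE; congr (_ * _).
(* Two signs cancel: the kernel has exponent [- alpha], and the norm is [p] to minus the
   valuation. *)
rewrite (cpow_padic_norm _ (ballN_neq0 ti)) -exprz_inv.
have -> : cpow (p%:R : R) (- alpha i) = (cpow p%:R (alpha i))^-1.
  by rewrite /cpow mulNr cexpN.
by [].
Qed.

End Multiplier.

Theorem lemma4p1 (R : realType) (p : nat) (p_pr : prime p)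
    (mu : {measure set (borel (padic p_pr)) -> \bar R}) (haar_mu : is_haar mu)
    (n : nat) (n_gt0 : (0 < n)%N)
    (mun : {measure set (borel 'rV[padic p_pr]_n) -> \bar R})
    (mun_power : is_power_measure mu mun)
    (alpha : 'I_n -> R[i]) :
  (forall phi, lizorkin_Phi mun phi ->
    lizorkin_Phi mun (vladimirov mu alpha phi)) /\
  vladimirov mu alpha @` lizorkin_Phi mun = lizorkin_Phi mun.
Proof.
have inv phi : lizorkin_Phi mun phi -> lizorkin_Phi mun (vladimirov mu alpha phi).
  move=> [psi psiP <-]; exists (norm_multiplier alpha psi).
    exact: norm_multiplier_Psi.
  by rewrite (vladimirov_fourier haar_mu mun_power).
split=> //; apply/seteqP; split=> [_ [phi phiP <-]|_ [psi psiP <-]]; first exact: inv.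
(* The preimage of the transform of [psi] is the transform of [psi] times the inverse multiplier. *)
have psiP' := norm_multiplier_Psi (fun i => - alpha i) psiP.
exists (fourier mun (norm_multiplier (fun i => - alpha i) psi)).
  by exists (norm_multiplier (fun i => - alpha i) psi).
by rewrite (vladimirov_fourier haar_mu mun_power) // norm_multiplierNK.
Qed.
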